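(* Let $Y$ be a Banach space. The following statements are equivalent: (i) $Y$ is WLD and $(B_{Y^*},w^* )$ has property (M). (ii) The Lebesgue-Bochner space $L_1(\mu,Y)$ is WLD for every finite measure $\mu$.
   Context: All Banach spaces are real; an operator is a continuous linear map. $(B_{Y^*},w^* )$ is the closed unit ball of $Y^*$ with the weak$^*$ topology. For a non-empty set $\Gamma$, $\ell_\infty^c(\Gamma)$ is the subspace of $\ell_\infty(\Gamma)$ consisting of all bounded functions $f:\Gamma\to\mathbb{R}$ with countable support, and $\tau_p(\Gamma)$ is the topology of pointwise convergence on $\Gamma$. A Banach space $X$ is weakly Lindelöf determined (WLD) if there exist a non-empty set $\Gamma$ and an injective operator $\Phi:X^*\to\ell_\infty^c(\Gamma)$ which is $w^*$-to-$\tau_p(\Gamma)$ continuous. Equivalently, $(B_{X^*},w^* )$ is a Corson compact space, i.e. it embeds homeomorphically into $[-1,1]^\Gamma\cap\ell_\infty^c(\Gamma)$ with $\tau_p(\Gamma)$ for some $\Gamma$. A Corson compact space $K$ has property (M) if every regular Borel probability measure on $K$ has separable support. *)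

(* Defs.v *)
From HB Require Import structures.
From mathcomp Require Import all_boot all_order all_algebra.
From mathcomp Require Import ring_quotient generic_quotient.
From mathcomp Require Import all_classical all_reals all_analysis.
From mathcomp Require Import measurable_realfun.
Set Implicit Arguments.
Unset Strict Implicit.
Unset Printing Implicit Defensive.
Import Order.TTheory GRing.Theory Num.Theory.
Import numFieldNormedType.Exports.
Local Open Scope classical_set_scope.
Local Open Scope ring_scope.

Section Dual.
Context (R : realType) (X : normedModType R).

Definition dual_pred : {pred X -> R^o} :=
  mem [set f : X -> R^o | linear f /\ continuous f].

Record dual := Dual { dual_fun :> X -> R^o; dualP : dual_fun \in dual_pred }.

HB.instance Definition _ := [isSub for dual_fun].
HB.instance Definition _ := [Choice of dual by <:].

Lemma dual_submod_closed : submod_closed dual_pred.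
Proof.
split=> [|a f g]; rewrite !inE.
  split=> [b u v|]; first by rewrite /= scaler0 addr0.
  by move=> x; exact: cvg_cst.
move=> [lf cf] [lg cg]; split=> [b u v|x].
  rewrite !fctE/= lf lg !scalerDr !scalerA (mulrC a b).
  by rewrite addrACA.
by apply: cvgD; [apply: cvgZr; exact: cf|exact: cg].
Qed.

HB.instance Definition _ :=
  GRing.isSubmodClosed.Build R _ dual_pred dual_submod_closed.
HB.instance Definition _ := [SubChoice_isSubLmodule of dual by <:].

Lemma dual_linear (f : dual) : linear (f : X -> R^o).
Proof. by have := dualP f; rewrite inE => -[]. Qed.

Lemma dual_continuous (f : dual) : continuous (f : X -> R^o).
Proof. by have := dualP f; rewrite inE => -[]. Qed.

HB.instance Definition _ (f : dual) :=
  GRing.isLinear.Build R X R^o _ (dual_fun f) (dual_linear f).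

Definition dual_norm (f : dual) : R :=
  sup [set `|f x| | x in [set x : X | `|x| <= 1]].

Lemma dual_has_sup (f : dual) :
  has_sup [set `|f x| | x in [set x : X | `|x| <= 1]].
Proof.
split; first by exists `|f 0|, 0 => //=; rewrite normr0.
have /linear_bounded_continuous/bounded_funP/(_ 1)[M fM] :=
  @dual_continuous f.
by exists M => _ [x /= x1 <-]; exact: fM.
Qed.

Lemma dual_normP (f : dual) (x : X) : `|f x| <= dual_norm f * `|x|.
Proof.
have [->|x0] := eqVneq x 0; first by rewrite linear0 !normr0 mulr0.
have nx : 0 < `|x| by rewrite normr_gt0.
rewrite -ler_pdivrMr//.
apply: (sup_ubound (dual_has_sup f).2).
exists (`|x|^-1 *: x) => /=; first by rewrite normfZV.
by rewrite linearZ/= normrM ger0_norm ?invr_ge0// mulrC.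
Qed.

Lemma dual_norm_le (f : dual) (M : R) :
  (forall x, `|x| <= 1 -> `|f x| <= M) -> dual_norm f <= M.
Proof.
move=> fM; apply: ge_sup; first exact: (dual_has_sup f).1.
by move=> _ [x /= x1 <-]; exact: fM.
Qed.

Lemma dual_norm_ge0 (f : dual) : 0 <= dual_norm f.
Proof.
rewrite (le_trans (normr_ge0 (f 0)))//.
by apply: (sup_ubound (dual_has_sup f).2); exists 0; rewrite //= normr0.
Qed.

Lemma dual_ler_normD (f g : dual) :
  dual_norm (f + g) <= dual_norm f + dual_norm g.
Proof.
apply: dual_norm_le => x x1; rewrite (le_trans (ler_normD _ _))// lerD//.
  by rewrite (le_trans (dual_normP f x))// ler_piMr// dual_norm_ge0.
by rewrite (le_trans (dual_normP g x))// ler_piMr// dual_norm_ge0.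
Qed.

Lemma dual_normrZ_le (a : R) (f : dual) :
  dual_norm (a *: f) <= `|a| * dual_norm f.
Proof.
apply: dual_norm_le => x x1.
rewrite [`|_|]normrM ler_wpM2l//.
by rewrite (le_trans (dual_normP f x))// ler_piMr// dual_norm_ge0.
Qed.

Lemma dual_normrZ (a : R) (f : dual) :
  dual_norm (a *: f) = `|a| * dual_norm f.
Proof.
apply/eqP; rewrite eq_le dual_normrZ_le/=.
have [->|a0] := eqVneq a 0; first by rewrite normr0 mul0r dual_norm_ge0.
rewrite -ler_pdivlMl ?normr_gt0//.
rewrite -{1}(scalerK a0 f) (le_trans (dual_normrZ_le _ _))//.
by rewrite normfV.
Qed.

Lemma dual_normr0_eq0 (f : dual) : dual_norm f = 0 -> f = 0.
Proof.
move=> f0; apply/val_inj/funext => x /=; apply/eqP.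
by rewrite -normr_le0 (le_trans (dual_normP f x))// f0 mul0r.
Qed.

HB.instance Definition _ := Lmodule_isNormed.Build R dual
  dual_ler_normD dual_normrZ dual_normr0_eq0.

(* Same carrier as dual, which carries the norm topology. The initial topology
   of the inclusion into X -> R with pointwise convergence is the initial
   topology of the evaluations f |-> f x, x in X. *)
Definition weak_star : Type :=
  initial_topology (dual_fun : dual -> {ptws X -> R}).
HB.instance Definition _ := Topological.on weak_star.

(* Closed unit ball of the dual, as a subspace of weak_star. *)
Definition dual_ball : Type :=
  set_type ([set f | `|f : dual| <= 1] : set weak_star).
HB.instance Definition _ := Topological.on dual_ball.

Lemma dual_ball0 : (0 : dual) \in ([set f | `|f : dual| <= 1] : set weak_star).
Proof. by rewrite inE/= normr0. Qed.

HB.instance Definition _ := isPointed.Build dual_ball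
  (SigSub dual_ball0).

End Dual.
Arguments weak_star {R} X.
Arguments dual_ball {R} X.
Arguments dual {R} X.

Section LinftyC.
Context (R : realType) (Gamma : Type).

Definition linfty_c_pred : {pred Gamma -> R^o} :=
  mem [set f : Gamma -> R^o |
    (exists M : R, forall g, `|f g| <= M) /\ countable [set g | f g != 0]].

Record linfty_c := LinftyC {
  linfty_c_fun :> Gamma -> R^o; linfty_cP : linfty_c_fun \in linfty_c_pred }.

HB.instance Definition _ := [isSub for linfty_c_fun].
HB.instance Definition _ := [Choice of linfty_c by <:].

Lemma linfty_c_submod_closed : submod_closed linfty_c_pred.
Proof.
split=> [|a f g]; rewrite !inE.
  split; first by exists 0 => g; rewrite normr0.
  by apply: (sub_countable _ (@countable0 Gamma)); apply: subset_card_le => g /=; rewrite eqxx.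
move=> [[M fM] cf] [[N gN] cg]; split.
  exists (`|a| * M + N) => x; rewrite (le_trans (ler_normD _ _))// lerD//.
  by rewrite normrZ ler_wpM2l.
have cfg : countable (\bigcup_(b in [set: bool])
    if b then [set x | f x != 0] else [set x | g x != 0]).
  by apply: bigcup_countable => // -[].
apply: sub_countable cfg; apply: subset_card_le => x /= fgx.
suff [fx|gx] : f x != 0 \/ g x != 0 by [exists true|exists false].
move: fgx.
apply: contraPP => /not_orP[/negP + /negP]; rewrite !negbK => /eqP f0 /eqP g0.
by rewrite !fctE f0 g0 scaler0 addr0 eqxx.
Qed.

HB.instance Definition _ :=
  GRing.isSubmodClosed.Build R _ linfty_c_pred linfty_c_submod_closed.
HB.instance Definition _ := [SubChoice_isSubLmodule of linfty_c by <:].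

(* sup set0 = 0, so this is also right when Gamma is empty. *)
Definition sup_norm (f : linfty_c) : R := sup (range (fun g => `|f g|)).

Lemma sup_norm_ubound (f : linfty_c) g : `|f g| <= sup_norm f.
Proof.
apply: sup_ubound; last by exists g.
have := linfty_cP f; rewrite inE => -[[M fM] _].
by exists M => _ [x _ <-].
Qed.

Lemma sup_norm_ge0 (f : linfty_c) : 0 <= sup_norm f.
Proof.
have [[g _]|] := pselect (exists g : Gamma, True).
  exact: le_trans (sup_norm_ubound f g).
move=> h; have E : range (fun g => `|f g|) = set0.
  by apply/seteqP; split=> // y [g _ _]; case: h; exists g.
by rewrite /sup_norm E sup0.
Qed.

Lemma sup_norm_le (f : linfty_c) M : 0 <= M ->
  (forall g, `|f g| <= M) -> sup_norm f <= M.
Proof.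
move=> M0 fM; have [[g _]|h] := pselect (exists g : Gamma, True).
  by apply: ge_sup => [|_ [x _ <-]//]; exists `|f g|, g.
have E : range (fun g => `|f g|) = set0.
  by apply/seteqP; split=> // y [g _ _]; case: h; exists g.
by rewrite /sup_norm E sup0.
Qed.

Lemma sup_ler_normD (f g : linfty_c) :
  sup_norm (f + g) <= sup_norm f + sup_norm g.
Proof.
apply: sup_norm_le => [|x]; first by rewrite addr_ge0 ?sup_norm_ge0.
by rewrite (le_trans (ler_normD _ _))// lerD ?sup_norm_ubound.
Qed.

Lemma sup_normrZ_le (a : R) (f : linfty_c) :
  sup_norm (a *: f) <= `|a| * sup_norm f.
Proof.
apply: sup_norm_le => [|x]; first by rewrite mulr_ge0 ?sup_norm_ge0.
by rewrite [`|_|]normrM ler_wpM2l ?sup_norm_ubound.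
Qed.

Lemma sup_normrZ (a : R) (f : linfty_c) :
  sup_norm (a *: f) = `|a| * sup_norm f.
Proof.
apply/eqP; rewrite eq_le sup_normrZ_le/=.
have [->|a0] := eqVneq a 0; first by rewrite normr0 mul0r sup_norm_ge0.
rewrite -ler_pdivlMl ?normr_gt0//.
rewrite -{1}(scalerK a0 f) (le_trans (sup_normrZ_le _ _))//.
by rewrite normfV.
Qed.

Lemma sup_normr0_eq0 (f : linfty_c) : sup_norm f = 0 -> f = 0.
Proof.
move=> f0; apply/val_inj/funext => x /=; apply/eqP.
by rewrite -normr_le0 -f0 sup_norm_ubound.
Qed.

HB.instance Definition _ := Lmodule_isNormed.Build R linfty_c
  sup_ler_normD sup_normrZ sup_normr0_eq0.

(* Same carrier as linfty_c, which carries the sup norm topology. *)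
Definition linfty_c_ptws : Type :=
  initial_topology (linfty_c_fun : linfty_c -> {ptws Gamma -> R}).
HB.instance Definition _ := Topological.on linfty_c_ptws.

End LinftyC.

(* Phi is linear and norm-to-norm continuous (an operator), and in addition
   weak*-to-pointwise continuous. *)
Definition WLD (R : realType) (X : completeNormedModType R) : Prop :=
  exists (Gamma : Type) (_ : inhabited Gamma)
    (Phi : {linear dual X -> linfty_c R Gamma}),
    [/\ continuous Phi, injective Phi &
        continuous (Phi : weak_star X -> linfty_c_ptws R Gamma)].

Definition separable_set (K : topologicalType) (A : set K) : Prop :=
  exists D : set K, [/\ countable D, D `<=` A & A `<=` closure D].

Definition borel (K : ptopologicalType) : Type :=
  g_sigma_algebraType (@open K).
HB.instance Definition _ (K : ptopologicalType) := Measurable.on (borel K).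

Section PropertyM.
Context (R : realType) (K : ptopologicalType).
Implicit Type P : probability (borel K) R.

(* On a Hausdorff space closed C follows from compact C; it is there so that
   P C is the measure of a Borel set on any space. *)
Definition regular_measure P : Prop := forall A : set (borel K), measurable A ->
  P A = ereal_inf [set P U | U in [set U : set K | open U /\ A `<=` U]] /\
  P A = ereal_sup
    [set P C | C in [set C : set K | [/\ compact C, closed C & C `<=` A]]].

(* Complement of the union of the open null sets; when P is regular this is the
   smallest closed set of full measure. *)
Definition measure_support P : set K :=
  [set x | forall U : set K, open U -> U x -> (0 < P U)%E].

Definition property_M : Prop := forall P, regular_measure P -> separable_set (measure_support P).

End PropertyM.

Section SimpleFunctions.
Context d (T : measurableType d).

Definition simple_fun (V : Type) (s : T -> V) : Prop :=
  finite_set (range s) /\ forall y, measurable (s @^-1` [set y]).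

Lemma simple_preimage (V : Type) (s : T -> V) (A : set V) :
  simple_fun s -> measurable (s @^-1` A).
Proof.
move=> [fs ms].
have -> : s @^-1` A = \bigcup_(y in range s `&` A) s @^-1` [set y].
  apply/seteqP; split=> x /=; first by move=> Ax; exists (s x) => //; split=> //; exists x.
  by move=> [y [_ Ay] /= ->].
apply: fin_bigcup_measurable => [|y _]; last exact: ms.
by apply: sub_finite_set fs => y [].
Qed.

Lemma simple_comp2 (V W Z : Type) (h : V -> W -> Z) (s : T -> V) (t : T -> W) :
  simple_fun s -> simple_fun t -> simple_fun (fun x => h (s x) (t x)).
Proof.
move=> ss st; split.
  have := finite_image (fun p : V * W => h p.1 p.2) (finite_setX ss.1 st.1).
  apply: sub_finite_set => _ [x _ <-]; exists (s x, t x) => //=.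
  by split; exists x.
move=> z.
have -> : (fun x => h (s x) (t x)) @^-1` [set z] =
    \bigcup_(y in range s) (s @^-1` [set y] `&` t @^-1` [set w | h y w = z]).
  apply/seteqP; split=> x /=; first by move=> E; exists (s x) => //; exists x.
  by move=> [y _ [/= -> ->]].
apply: fin_bigcup_measurable; first exact: ss.1.
by move=> y _; apply: measurableI; exact: simple_preimage.
Qed.

Lemma simple_cst (V : Type) (v : V) : simple_fun (fun _ : T => v).
Proof.
split; first by apply: sub_finite_set (finite_set1 v) => _ [x _ <-].
move=> y; have [->|vy] := pselect (v = y).
  by rewrite [X in measurable X](_ : _ = setT)//; apply/seteqP; split.
by rewrite [X in measurable X](_ : _ = set0)//; apply/seteqP; split.
Qed.

Lemma simple_comp (V Z : Type) (h : V -> Z) (s : T -> V) :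
  simple_fun s -> simple_fun (h \o s).
Proof. by move=> ss; exact: (simple_comp2 (fun v (_ : unit) => h v) ss (simple_cst tt)). Qed.

Lemma simple_if (V : Type) (A : set T) (s t : T -> V) : measurable A ->
  simple_fun s -> simple_fun t -> simple_fun (fun x => if x \in A then s x else t x).
Proof.
move=> mA ss st.
have sA : simple_fun (fun x => x \in A).
  split; first exact: finite_finset.
  move=> [].
    by rewrite [X in measurable X](_ : _ = A)//; apply/seteqP; split=> x /= => [/set_mem|/mem_set].
  rewrite [X in measurable X](_ : _ = ~` A); first exact: measurableC.
  by apply/seteqP; split=> x /=; [move=> /negbT|move=> ?; apply/negbTE];
    rewrite notin_setE.
have := simple_comp2 (fun (p : V * V) (b : bool) => if b then p.1 else p.2)
  (simple_comp2 pair ss st) sA.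
by [].
Qed.

Lemma simple_measurable (R : realType) (s : T -> R) :
  simple_fun s -> measurable_fun setT s.
Proof. by move=> ss _ A _; rewrite setTI; exact: simple_preimage. Qed.

End SimpleFunctions.

Section StronglyMeasurable.
Context d (T : measurableType d) (R : realType).
Context (mu : {measure set T -> \bar R}) (Y : normedModType R).
Implicit Types f g : T -> Y.

(* Strong (Bochner) measurability with respect to mu: almost everywhere limit of
   simple functions. *)
Definition strongly_measurable f : Prop :=
  exists s : nat -> T -> Y, (forall n, simple_fun (s n)) /\
    {ae mu, forall x, s n x @[n --> \oo] --> f x}.

(* mu need not be complete, so the norm of a strongly measurable f need only be
   almost everywhere equal to a measurable function. The integral of a
   nonnegative function is the supremum of the integrals of the simple functions
   below it, whether or not it is measurable, so here it is the integral with
   respect to the completion of mu; see ae_integral. *)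
Definition int_norm f : \bar R := (\int[mu]_x (`|f x|)%:E)%E.

Lemma strongly_measurableP f : strongly_measurable f ->
  exists g (s : nat -> T -> Y), [/\ forall n, simple_fun (s n),
    forall x, s n x @[n --> \oo] --> g x & {ae mu, forall x, f x = g x}].
Proof.
move=> [s [ss [N [mN N0 sN]]]].
exists (fun x => if x \in N then 0 else f x),
  (fun n x => if x \in N then 0 else s n x); split.
- by move=> n; apply: simple_if => //; exact: simple_cst.
- move=> x; case: (boolP (x \in N)) => xN; first exact: cvg_cst.
  apply: contrapT => nc; move/negP: xN; apply; rewrite inE; exact: sN.
- exists N; split=> // x /=; case: (boolP (x \in N)); rewrite ?inE//.
Qed.

Lemma limit_measurable (s : nat -> T -> Y) g :
  (forall n, simple_fun (s n)) -> (forall x, s n x @[n --> \oo] --> g x) ->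
  measurable_fun setT (fun x => (`|g x|)%:E).
Proof.
move=> ss sg.
apply: (emeasurable_fun_cvg (fun n x => (`|s n x|)%:E)).
  move=> n; apply/measurable_EFinP/simple_measurable.
  exact: (simple_comp (fun v : Y => `|v|) (ss n)).
move=> x _; apply: cvg_EFin; first exact: nearW.
by apply: cvg_norm; exact: sg.
Qed.

Import HBNNSimple.

Lemma ae_integral_le (f g : T -> \bar R) : (forall x, 0 <= f x)%E ->
  (forall x, 0 <= g x)%E -> {ae mu, forall x, f x = g x} ->
  (\int[mu]_x f x <= \int[mu]_x g x)%E.
Proof.
move=> f0 g0 [N [mN N0 sN]].
rewrite ge0_integralTE// [leRHS]ge0_integralTE//.
apply: ge_ereal_sup => _ [h /= hf <-].
pose k := mul_nnsfun h (indic_nnsfun R (measurableC mN)).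
have kE y : k y = h y * (y \in ~` N)%:R by [].
apply: (@le_trans _ _ (sintegral mu k)).
  rewrite -!integralT_nnsfun.
  rewrite le_eqVlt; apply/orP; left; apply/eqP.
  apply: ge0_ae_eq_integral => //.
  - exact/measurable_EFinP.
  - exact/measurable_EFinP.
  - by move=> x _; rewrite lee_fin.
  - by move=> x _; rewrite lee_fin.
  exists N; split=> // x hx; apply: contrapT => Nx; apply: hx => _ /=.
  by congr EFin; apply: esym; rewrite -[LHS]/(k x) kE mem_set ?mulr1.
apply: ereal_sup_ubound; exists k => // x.
rewrite kE; case: (boolP (x \in ~` N)) => [|_]; last by rewrite mulr0.
rewrite inE => Nx; rewrite mulr1.
have -> : g x = f x by apply: contrapT => gf; apply: Nx; apply: sN => /= fg; exact: gf.
exact: hf.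
Qed.

Lemma ae_integral (f g : T -> \bar R) : (forall x, 0 <= f x)%E ->
  (forall x, 0 <= g x)%E -> {ae mu, forall x, f x = g x} ->
  (\int[mu]_x f x = \int[mu]_x g x)%E.
Proof.
move=> f0 g0 fg; apply/eqP; rewrite eq_le !ae_integral_le//.
by apply: filterS fg.
Qed.

Lemma ae_int_norm f g : {ae mu, forall x, f x = g x} -> int_norm f = int_norm g.
Proof.
move=> fg; apply: ae_integral => [x|x|]; rewrite ?lee_fin//.
by apply: filterS fg => x ->.
Qed.

Lemma int_norm_ge0 f : (0 <= int_norm f)%E.
Proof. by apply: integral_ge0 => x _; rewrite lee_fin. Qed.

Lemma strongly_measurableD f g : strongly_measurable f ->
  strongly_measurable g -> strongly_measurable (f + g).
Proof.
move=> [s [ss sf]] [t [st tg]].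
exists (fun n x => s n x + t n x); split.
  by move=> n; exact: (simple_comp2 +%R (ss n) (st n)).
by apply: filterS2 sf tg => x sf tg; exact: cvgD.
Qed.

Lemma strongly_measurableZ (a : R) f : strongly_measurable f ->
  strongly_measurable (a *: f).
Proof.
move=> [s [ss sf]]; exists (fun n x => a *: s n x); split.
  by move=> n; exact: (simple_comp ( *:%R a) (ss n)).
by apply: filterS sf => x sf; exact: cvgZl_tmp.
Qed.

Lemma strongly_measurable0 : strongly_measurable 0.
Proof.
exists (fun _ _ => 0); split; first by move=> n; exact: simple_cst.
by apply: aeW => x; exact: cvg_cst.
Qed.

Lemma int_normD f g : strongly_measurable f -> strongly_measurable g ->
  (int_norm (f + g)%R <= int_norm f + int_norm g)%E.
Proof.
move=> /strongly_measurableP[f' [s [ss sf ff']]].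
move=> /strongly_measurableP[g' [t [st tg gg']]].
rewrite (ae_int_norm ff') (ae_int_norm gg') (@ae_int_norm _ (f' + g')); last first.
  by apply: filterS2 ff' gg' => x; rewrite !fctE => -> ->.
have mf := limit_measurable ss sf.
have mg := limit_measurable st tg.
rewrite /int_norm -ge0_integralD//.
apply: ge0_le_integral => //.
- apply: (@limit_measurable (fun n x => s n x + t n x)).
    by move=> n; exact: (simple_comp2 +%R (ss n) (st n)).
  by move=> x; exact: cvgD.
- exact: emeasurable_funD.
- by move=> x _; rewrite -EFinD lee_fin ler_normD.
Qed.

Lemma int_normZ (a : R) f : strongly_measurable f ->
  int_norm (a *: f) = (`|a|%:E * int_norm f)%E.
Proof.
move=> /strongly_measurableP[f' [s [ss sf ff']]].
rewrite (ae_int_norm ff') (@ae_int_norm _ (a *: f')); last first.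
  by apply: filterS ff' => x; rewrite !fctE => ->.
have mf := limit_measurable ss sf.
rewrite /int_norm -ge0_integralZl_EFin//.
by apply: eq_integral => x _; rewrite -EFinM normrZ.
Qed.

Lemma int_norm_eq0 f : strongly_measurable f -> int_norm f = 0%E ->
  {ae mu, forall x, f x = 0}.
Proof.
move=> /strongly_measurableP[f' [s [ss sf ff']]].
rewrite (ae_int_norm ff') => f0.
have mf := limit_measurable ss sf.
have /(ae_eq_integral_abs mu measurableT mf) : (\int[mu]_x `|(`|f' x|)%:E| = 0)%E.
  by rewrite -f0; apply: eq_integral => x _; rewrite gee0_abs ?lee_fin.
move=> f'0; apply: filterS2 ff' f'0 => x -> /(_ I)[/eqP].
by rewrite normr_eq0 => /eqP.
Qed.

End StronglyMeasurable.

Section LebesgueBochner.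
Context d (T : measurableType d) (R : realType).
Context (mu : {measure set T -> \bar R}) (Y : normedModType R).

Definition bochner_pred : {pred T -> Y} :=
  mem [set f | strongly_measurable mu f /\ (int_norm mu f < +oo)%E].

Record bochner := Bochner {
  bochner_fun :> T -> Y; bochnerP : bochner_fun \in bochner_pred }.

HB.instance Definition _ := [isSub for bochner_fun].
HB.instance Definition _ := [Choice of bochner by <:].

Lemma bochner_submod_closed : submod_closed bochner_pred.
Proof.
split=> [|a f g]; rewrite !inE.
  split; first exact: strongly_measurable0.
  rewrite /int_norm (eq_integral (cst 0%E)) ?integral0//.
  by move=> x _; rewrite normr0.
move=> [mf f_fin] [mg g_fin]; have maf := strongly_measurableZ a mf.
split; first exact: strongly_measurableD.
apply: le_lt_trans (int_normD maf mg) _.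
by rewrite int_normZ// lte_add_pinfty// lte_mul_pinfty.
Qed.

HB.instance Definition _ :=
  GRing.isSubmodClosed.Build R _ bochner_pred bochner_submod_closed.
HB.instance Definition _ := [SubChoice_isSubLmodule of bochner by <:].

Lemma bochner_measurable (f : bochner) : strongly_measurable mu f.
Proof. by have := bochnerP f; rewrite inE => -[]. Qed.

Lemma bochner_fin (f : bochner) : int_norm mu f \is a fin_num.
Proof.
have := bochnerP f; rewrite inE => -[_ ?].
by rewrite ge0_fin_numE// int_norm_ge0.
Qed.

Definition ae_zero : {pred bochner} :=
  mem [set f : bochner | {ae mu, forall x, f x = 0}].

Lemma ae_zero_zmod_closed : zmod_closed ae_zero.
Proof.
split=> [|f g]; rewrite !inE/=; first exact: aeW.
move=> f0 g0; apply: filterS2 f0 g0 => x fx gx.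
by rewrite -[LHS]/(f x - g x) fx gx subr0.
Qed.

HB.instance Definition _ :=
  GRing.isZmodClosed.Build bochner ae_zero ae_zero_zmod_closed.

(* Lebesgue-Bochner space: Bochner integrable functions modulo almost everywhere
   equality (see L1P), normed by the integral of the pointwise norm. *)
Definition L1 : Type := Quotient.quot ae_zero.
HB.instance Definition _ := Choice.on L1.
HB.instance Definition _ := EqQuotient.on L1.
HB.instance Definition _ := GRing.Zmodule.on L1.

Local Open Scope quotient_scope.

Lemma L1P (f g : bochner) :
  (\pi_L1 f = \pi_L1 g) <-> {ae mu, forall x, f x = g x}.
Proof.
have E : (\pi_L1 f = \pi_L1 g) <-> f - g \in ae_zero.
  rewrite (Quotient.idealrBE ae_zero); split; by move=> /eqP.
have Efg x : (f - g) x = f x - g x by [].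
rewrite E inE; split; apply: filterS => x.
  by rewrite Efg => /eqP; rewrite subr_eq0 => /eqP.
by move=> fg; rewrite Efg fg subrr.
Qed.

Lemma L1_reprP (f : bochner) : {ae mu, forall x, repr (\pi_L1 f) x = f x}.
Proof. by apply/L1P; rewrite reprK. Qed.

Lemma L1_piD (f g : bochner) : \pi_L1 (f + g) = \pi_L1 f + \pi_L1 g.
Proof. exact: (Quotient.pi_add ae_zero). Qed.

Definition L1_scale (a : R) (q : L1) : L1 := \pi_L1 (a *: repr q).

Lemma L1_piZ a (f : bochner) : L1_scale a (\pi_L1 f) = \pi_L1 (a *: f).
Proof.
apply/L1P; have := L1_reprP f; apply: filterS => x E.
by rewrite -[LHS]/(a *: (repr (\pi_L1 f) x)) E.
Qed.

Lemma L1_scalerA a b q : L1_scale a (L1_scale b q) = L1_scale (a * b) q.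
Proof. by rewrite [L1_scale b q]/L1_scale L1_piZ scalerA. Qed.

Lemma L1_scale1r : left_id 1 L1_scale.
Proof. by move=> q; rewrite /L1_scale scale1r reprK. Qed.

Lemma L1_scalerDr : right_distributive L1_scale +%R.
Proof.
move=> a p q; rewrite -{1}[p]reprK -{1}[q]reprK -L1_piD L1_piZ scalerDr.
by rewrite L1_piD.
Qed.

Lemma L1_scalerDl q : {morph L1_scale^~ q : a b / a + b}.
Proof. by move=> a b; rewrite /L1_scale scalerDl L1_piD. Qed.

HB.instance Definition _ := GRing.Zmodule_isLmodule.Build R L1
  L1_scalerA L1_scale1r L1_scalerDr L1_scalerDl.

Definition L1_norm (q : L1) : R := fine (int_norm mu (repr q)).

Lemma L1_norm_pi (f : bochner) : L1_norm (\pi_L1 f) = fine (int_norm mu f).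
Proof. by rewrite /L1_norm (ae_int_norm (L1_reprP f)). Qed.

Lemma L1_ler_normD p q : L1_norm (p + q) <= L1_norm p + L1_norm q.
Proof.
rewrite -[p]reprK -[q]reprK -L1_piD !L1_norm_pi.
rewrite -fineD; [|exact: bochner_fin|exact: bochner_fin].
apply: fine_le; first exact: bochner_fin.
  by rewrite fin_numD; apply/andP; split; exact: bochner_fin.
exact: (int_normD (bochner_measurable (repr p)) (bochner_measurable (repr q))).
Qed.

Lemma L1_normrZ a q : L1_norm (a *: q) = `|a| * L1_norm q.
Proof.
rewrite -[q]reprK [_ *: _]L1_piZ !L1_norm_pi.
rewrite (int_normZ a (bochner_measurable (repr q))).
by rewrite fineM ?bochner_fin.
Qed.

Lemma L1_normr0_eq0 q : L1_norm q = 0 -> q = 0.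
Proof.
rewrite -[q]reprK L1_norm_pi => q0.
have -> : (0 : L1) = \pi_L1 0 by apply: (addrI (\pi_L1 0)); rewrite addr0 -L1_piD addr0.
apply/L1P/int_norm_eq0; first exact: bochner_measurable.
by rewrite -[LHS]fineK ?bochner_fin// q0.
Qed.

HB.instance Definition _ := Lmodule_isNormed.Build R L1
  L1_ler_normD L1_normrZ L1_normr0_eq0.

End LebesgueBochner.

Section L1_complete.
Context d (T : measurableType d) (R : realType).
Context (mu : {measure set T -> \bar R}) (Y : completeNormedModType R).
Local Notation L1 := (L1 mu Y).
Local Notation bochner := (bochner mu Y).
Local Open Scope quotient_scope.

Lemma L1_distE (f g : bochner) :
  (`|\pi_L1 f - \pi_L1 g|)%:E = int_norm mu (fun x => f x - g x).
Proof.
have <- : \pi_L1 (f - g) = \pi_L1 f - \pi_L1 g.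
  by apply: (addIr (\pi_L1 g)); rewrite subrK -L1_piD subrK.
rewrite -[`|_|]/(L1_norm _) L1_norm_pi fineK ?bochner_fin//.
Qed.

Lemma simple_strongly_measurable (s : T -> Y) :
  simple_fun s -> strongly_measurable mu s.
Proof.
by move=> ss; exists (fun=> s); split=> //; apply: aeW => x; exact: cvg_cst.
Qed.

Lemma truncation (f : bochner) : exists t : nat -> T -> Y,
  [/\ forall n, simple_fun (t n), forall n, (int_norm mu (t n) < +oo)%E &
      int_norm mu (fun x => t n x - f x) @[n --> \oo] --> 0%E].
Proof.
have [f' [s [ss sf ff']]] := strongly_measurableP (bochner_measurable f).
have mf := limit_measurable ss sf.
have mf' : measurable_fun setT (fun x => 2 * `|f' x|).
  by apply: measurable_funM => //; exact/measurable_EFinP.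
have ms n : measurable_fun setT (fun x => `|s n x|).
  exact: (simple_measurable (simple_comp (fun v : Y => `|v|) (ss n))).
have mA n : measurable [set x | `|s n x| <= 2 * `|f' x|].
  by rewrite -[X in measurable X]setTI; exact: measurable_fun_le.
pose t n x := if x \in [set x | `|s n x| <= 2 * `|f' x|] then s n x else 0.
have st n : simple_fun (t n) by apply: simple_if => //; exact: simple_cst.
have tf' n x : `|t n x| <= 2 * `|f' x|.
  by rewrite /t; case: ifPn => [/set_mem//|_]; rewrite normr0 mulr_ge0.
have tcvg x : t n x @[n --> \oo] --> f' x.
  have [f0|f0] := eqVneq (f' x) 0.
    rewrite f0; apply: cvg_near_cst; apply: nearW => n.
    by apply/eqP; rewrite -normr_le0 (le_trans (tf' n x))// f0 normr0 mulr0.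
  apply: cvg_trans (sf x); apply: near_eq_cvg.
  have lt2 : `|f' x| < 2 * `|f' x|.
    by rewrite ltr_pMl ?ltr1n// normr_gt0.
  have := cvgr_le _ (cvg_norm (sf x)) _ lt2.
  by move=> [M _ HM]; exists M => // n /HM /= sn; rewrite /t mem_set.
have f_fin : (\int[mu]_x (`|f' x|)%:E < +oo)%E.
  by rewrite -[ltLHS](ae_int_norm ff') ltey_eq bochner_fin.
exists t; split=> [//|n|].
  have mt : measurable_fun setT (fun x => (`|t n x|)%:E).
    by apply: (@limit_measurable _ _ _ _ (fun=> t n)) => // x; exact: cvg_cst.
  apply: (@le_lt_trans _ _ (\int[mu]_x (2%:E * (`|f' x|)%:E))%E).
    apply: ge0_le_integral => //; first exact/measurable_EFinP.
    by move=> x _; rewrite -EFinM lee_fin.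
  by rewrite ge0_integralZl_EFin// lte_mul_pinfty.
pose h n x : \bar R := (`|t n x - f' x|)%:E.
have mh n : measurable_fun setT (h n).
  apply: (@limit_measurable _ _ _ _ (fun m x => t n x - s m x)
    (fun x => t n x - f' x)) => [m|x].
    exact: (simple_comp2 (fun u v => u - v) (st n) (ss m)).
  by apply: cvgB; [exact: cvg_cst|exact: sf].
pose k x : \bar R := (3 * `|f' x|)%:E.
have mk : measurable_fun setT k.
  apply/measurable_EFinP; apply: measurable_funM => //.
  exact/measurable_EFinP.
have ik : mu.-integrable setT k.
  apply/integrableP; split=> //.
  rewrite (eq_integral (fun x => 3%:E * (`|f' x|)%:E)%E); last first.
    by move=> x _; rewrite gee0_abs ?lee_fin ?mulr_ge0.
  by rewrite ge0_integralZl_EFin// lte_mul_pinfty.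
have hk n x : (`|h n x| <= k x)%E.
  rewrite gee0_abs ?lee_fin//= (le_trans (ler_normB _ _))//.
  by rewrite -(natr1 2) mulrDl mul1r lerD2r.
have hcvg x : h n x @[n --> \oo] --> 0%E.
  apply: cvg_EFin; first exact: nearW.
  by apply/norm_cvg0P; apply/subr_cvg0; exact: tcvg.
have [_ _ ] := @dominated_convergence _ T R mu setT measurableT h (cst 0%E) k
  mh (measurable_cst _) (aeW _ (fun x _ => hcvg x)) ik (aeW _ (fun x n _ => hk n x)).
have E : (fun n => int_norm mu (fun x => t n x - f x)) =
    (fun n => \int[mu]_x h n x)%E.
  apply/funext => n; rewrite -[RHS]/(int_norm mu (fun x => t n x - f' x)).
  by apply: ae_int_norm; apply: filterS ff' => x ->.
by rewrite integral0 E.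
Qed.

Lemma simple_dense (f : bochner) (e : R) : 0 < e ->
  exists g : bochner, simple_fun g /\ `|\pi_L1 g - \pi_L1 f| < e.
Proof.
move=> e0; have [t [st tfin tcvg]] := truncation f.
have tP n : t n \in @bochner_pred _ _ _ mu Y.
  by rewrite inE; split; [exact: simple_strongly_measurable|exact: tfin].
have : \forall n \near \oo, (int_norm mu (fun x => t n x - f x)%R < e%:E)%E.
  by apply: (tcvg [set y | (y < e%:E)%E]); apply: open_ereal_lt'; rewrite lte_fin.
move=> [N _ /(_ N (leqnn N)) /= tN].
exists (Bochner (tP N)); split; first exact: st.
by have := tN; rewrite -[X in (X < _)%E](L1_distE (Bochner (tP N)) f) lte_fin.
Qed.

Lemma series_cvg (u : nat -> Y) :
  (\sum_(n <oo) (`|u n.+1 - u n|%R)%:E < +oo)%E -> cvgn u.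
Proof.
move=> sfin.
have cs : cvgn (series (telescope u)).
  apply: normed_cvg; apply: nondecreasing_is_cvgn.
    by apply/nondecreasing_seqP => n; rewrite /= !seriesEnat/= big_nat_recr//= lerDl.
  exists (fine (\sum_(n <oo) (`|u n.+1 - u n|%R)%:E)%E) => _ [n _ <-].
  rewrite -lee_fin fineK; last first.
    by rewrite ge0_fin_numE//; apply: nneseries_ge0 => m _ _; rewrite lee_fin.
  rewrite /= -sumEFin.
  apply: (@nneseries_lim_ge _ (fun n => (`|u n.+1 - u n|%R)%:E) xpredT).
  by move=> m _ _; rewrite lee_fin.
rewrite (_ : u = fun n => u 0%N + series (telescope u) n).
  by apply: is_cvgD => //; exact: is_cvg_cst.
by apply/funext => n; exact: eq_sum_telescope.
Qed.

Lemma cauchy_simple (F : set_system L1) : ProperFilter F -> cauchy F ->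
  exists g : nat -> bochner, forall n, simple_fun (g n) /\
    F [set q | `|\pi_L1 (g n) - q| < 2^-1 ^+ n].
Proof.
move=> FF cF.
suff H n : exists g : bochner, simple_fun g /\
    F [set q | `|\pi_L1 g - q| < 2^-1 ^+ n].
  by have [g Hg] := choice H; exists g.
have e0 : 0 < 2^-1 ^+ n / 2 :> R by rewrite divr_gt0// exprn_gt0.
have [p Fp] := (cauchyP _).1 cF _ e0.
have [g [sg]] := simple_dense (repr p) e0; rewrite reprK => gp.
exists g; split=> //; apply: filterS Fp => q; rewrite -ball_normE /= => pq.
rewrite (_ : _ - q = (\pi_L1 g - p) + (p - q)); last by rewrite addrA subrK.
by rewrite (le_lt_trans (ler_normD _ _))// [ltRHS]splitr ltrD.
Qed.

Lemma L1_cauchy_cvg (F : set_system L1) :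
  ProperFilter F -> cauchy F -> cvg F.
Proof.
move=> FF cF; have [g gP] := cauchy_simple FF cF.
have gdist n m : (n <= m)%N ->
    (int_norm mu (fun x => g m x - g n x)%R <= (2 * 2^-1 ^+ n)%:E)%E.
  move=> nm; rewrite -L1_distE lee_fin.
  have [q /= [qn qm]] := filter_ex (filterI (gP n).2 (gP m).2).
  rewrite (_ : _ - _ = (\pi_L1 (g m) - q) - (\pi_L1 (g n) - q)); last first.
    by rewrite opprB addrA subrK.
  rewrite (le_trans (ler_normB _ _))// mulrDl mul1r lerD// ?ltW//.
  rewrite (lt_le_trans qm)//.
  by rewrite ler_wiXn2l// ?invr_ge0// invf_le1 ?ler1n.
pose u n x : \bar R := (`|g n.+1 x - g n x|)%:E.
have mu_ n : measurable_fun setT (u n).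
  apply: (@limit_measurable _ _ _ _ (fun=> fun x => g n.+1 x - g n x)) => [_|x].
    exact: (simple_comp2 (fun u v => u - v) (gP n.+1).1 (gP n).1).
  exact: cvg_cst.
have u0 n x : (0 <= u n x)%E by rewrite lee_fin.
have su_fin : (\int[mu]_x (\sum_(n <oo) u n x) < +oo)%E.
  rewrite integral_nneseries//.
  apply: (@le_lt_trans _ _ (\sum_(n <oo) (2 * 2^-1 ^+ n)%:E)%E).
    apply: lee_nneseries => [n _ _|n _]; last exact: gdist.
    exact: integral_ge0.
  have /cvg_lim : eseries (fun n => (2 * 2^-1 ^+ n : R)%:E) @ \oo -->
      (2 * (1 - 2^-1)^-1 : R)%:E.
    rewrite (_ : eseries _ = EFin \o series (geometric 2 2^-1)).
      apply: cvg_EFin; first exact: nearW.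
      by apply: cvg_geometric_series; rewrite ger0_norm// invf_lt1 ?ltr1n.
    by apply/funext => n; rewrite /eseries/= sumEFin.
  by move=> -> //; rewrite ltry.
have mU : measurable_fun setT (fun x => \sum_(n <oo) u n x)%E.
  exact: ge0_emeasurable_sum.
have U0 x : (0 <= \sum_(n <oo) u n x)%E by apply: nneseries_ge0.
have iU : mu.-integrable setT (fun x => \sum_(n <oo) u n x)%E.
  apply/integrableP; split=> //.
  by rewrite (eq_integral (fun x => \sum_(n <oo) u n x)%E)// => x _; rewrite gee0_abs.
have [N [mN N0 sN]] := integrable_ae measurableT iU.
pose h n x := if x \in N then 0 else g n x.
pose l x := limn (h ^~ x).
have sh n : simple_fun (h n).
  by apply: simple_if => //; [exact: simple_cst|exact: (gP n).1].
have hl x : h n x @[n --> \oo] --> l x.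
  suff : cvgn (h ^~ x) by [].
  rewrite /h; case: (boolP (x \in N)) => xN; first exact: is_cvg_cst.
  apply: series_cvg; rewrite ltey_eq; apply/orP; left.
  apply: contrapT => nfin; move/negP : xN; apply; rewrite inE; apply: sN => /= /(_ I).
  exact: nfin.
have gh n : {ae mu, forall x, g n x = h n x}.
  exists N; split=> // x /=; rewrite /h; case: (boolP (x \in N)) => // xN.
  by rewrite inE in xN.
have hdist n : (int_norm mu (fun x => l x - h n x)%R <= (2 * 2^-1 ^+ n)%:E)%E.
  pose f m x : \bar R := (`|h m x - h n x|)%:E.
  have mf m : measurable_fun setT (f m).
    apply: (@limit_measurable _ _ _ _ (fun=> fun x => h m x - h n x)) => [_|x].
      exact: (simple_comp2 (fun u v => u - v) (sh m) (sh n)).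
    exact: cvg_cst.
  have f0 m x : (0 <= f m x)%E by rewrite lee_fin.
  have := @fatou _ T R mu setT measurableT f mf (fun m x _ => f0 m x).
  rewrite (eq_integral (fun x => (`|l x - h n x|)%:E)); last first.
    move=> x _; have fl : f m x @[m --> \oo] --> (`|l x - h n x|)%:E.
      apply: cvg_EFin; first exact: nearW.
      by apply: cvg_norm; apply: cvgB; [exact: hl|exact: cvg_cst].
    by rewrite (cvg_limn_einf_sup fl).1.
  move=> /le_trans; apply.
  rewrite limn_einf_lim; apply: lime_le; first exact: is_cvg_einfs.
  apply: nearW => k; apply: ereal_inf_le.
  exists (\int[mu]_x f (maxn k n) x)%E; first by exists (maxn k n) => //=; exact: leq_maxl.
  rewrite -[leLHS]/(int_norm mu (fun x => h (maxn k n) x - h n x)).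
  rewrite (@ae_int_norm _ _ _ mu Y _ (fun x => g (maxn k n) x - g n x)).
    exact/gdist/leq_maxr.
  by apply: filterS2 (gh (maxn k n)) (gh n) => x -> ->.
have ml : strongly_measurable mu l by exists h; split=> //; exact: aeW.
have lP : l \in @bochner_pred _ _ _ mu Y.
  rewrite inE; split=> //.
  have mh := simple_strongly_measurable (sh 0%N).
  have mlh : strongly_measurable mu (fun x => l x - h 0%N x).
    rewrite (_ : (fun _ => _) = l + (- 1) *: h 0%N).
      by apply: strongly_measurableD => //; exact: strongly_measurableZ.
    by apply/funext => x; rewrite !fctE scaleN1r.
  have -> : l = (fun x => l x - h 0%N x) + h 0%N.
    by apply/funext => x; rewrite !fctE subrK.
  apply: le_lt_trans (int_normD mlh mh) _.
  rewrite lte_add_pinfty//; first exact: le_lt_trans (hdist 0%N) (ltry _).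
  by rewrite -(ae_int_norm (gh 0%N)) ltey_eq bochner_fin.
have ldist n : `|\pi_L1 (Bochner lP) - \pi_L1 (g n)| <= 2 * 2^-1 ^+ n.
  rewrite -lee_fin L1_distE; apply: le_trans (hdist n).
  rewrite (@ae_int_norm _ _ _ mu Y _ (fun x => l x - h n x))//.
  by apply: filterS (gh n) => x /= ->.
apply/cvg_ex; exists (\pi_L1 (Bochner lP)).
apply/cvgrPdist_lt => e e0.
have : geometric 3 2^-1 n @[n --> \oo] --> (0 : R).
  by apply: cvg_geometric; rewrite ger0_norm// invf_lt1 ?ltr1n.
move=> /cvgrPdist_lt/(_ _ e0)[n _ /(_ n (leqnn n))] /=.
rewrite sub0r normrN ger0_norm ?mulr_ge0 ?exprn_ge0 ?invr_ge0// => ne.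
apply: filterS (gP n).2 => q /= qn.
rewrite (_ : _ - q = (\pi_L1 (Bochner lP) - \pi_L1 (g n)) + (\pi_L1 (g n) - q));
  last by rewrite addrA subrK.
rewrite (le_lt_trans (ler_normD _ _))// (le_lt_trans _ ne)//.
by rewrite -(natr1 2) mulrDl mul1r lerD// ltW.
Qed.

HB.instance Definition _ := Uniform_isComplete.Build L1 L1_cauchy_cvg.

End L1_complete.

(* Main.v *)
Require Import Defs.
From HB Require Import structures.
From mathcomp Require Import all_boot all_order all_algebra.
From mathcomp Require Import all_classical all_reals all_analysis.
From mathcomp Require Import measurable_realfun ring lra.
Set Implicit Arguments.
Unset Strict Implicit.
Unset Printing Implicit Defensive.
Import Order.TTheory GRing.Theory Num.Theory.
Import numFieldNormedType.Exports.
Local Open Scope classical_set_scope.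
Local Open Scope ring_scope.

(** Let Psi : Y^* -> linfty^c(Gamma) witness that Y is WLD, let K be the dual
    ball of Y and X = L1(mu, Y). A functional phi on X is handled through the
    functionals y |-> phi (h (x) y) on Y ([pull phi h]) for bounded measurable
    scalar h. Averaging phi over the blocks of a finite measurable partition p
    gives a simple field T -> K; the functionals phi_p it induces converge weak*
    to phi as p is refined.

    (i) => (ii). Pushing mu forward along the averaged fields and taking an
    ultralimit over partitions gives a finitely additive probability on K, which
    is regularised to a Radon measure. By (M) its support is determined by
    countably many coordinates of Psi, so only countably many coordinates g
    satisfy Psi (pull phi 1_A) g <> 0 for some A. Indexing moreover by a maximal
    orthonormal system of bounded functions (Bessel for countability,
    Radon-Nikodym for totality) turns Psi into a witness for X.

    (ii) => (i). For mu a Dirac mass X is Y. For a regular probability P on K let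
    phi f = \int k (f k) dP(k). Since dual balls of WLD spaces are countably
    tight, phi is a cluster point of a sequence of phi_p; each phi_p only sees
    countably many coordinates, hence so does phi, and so the support of P is a
    compact set whose points are separated by countably many coordinates. *)

(** * The weak* topology of the dual ball *)

Lemma ultra_fmap (I J : Type) (F : set_system I) (f : I -> J) :
  UltraFilter F -> UltraFilter (f @ F).
Proof.
move=> UF; split; first exact: fmap_proper_filter.
move=> G PG FG; apply/seteqP; split=> // A GA.
have [//|FC] := in_ultra_setVsetC (f @^-1` A) UF.
have GC : G (~` A) by exact: FG.
by have [x []] := filter_ex (filterI GA GC).
Qed.

Lemma ultra_bounded_cvg (R : realType) (I : Type) (F : set_system I)
    (f : I -> R) (M : R) : UltraFilter F -> (forall i, `|f i| <= M) ->
  exists l : R, f @ F --> l.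
Proof.
move=> UF fM; have := @segment_compact R (- M) M.
rewrite compact_ultra => /(_ (f @ F) (ultra_fmap f UF)) [].
  by apply: (@nearW _ F) => i /=; rewrite in_itv/= -ler_norml.
by move=> l [_ ?]; exists l.
Qed.

Section WeakStarTopology.
Context (R : realType) (X : normedModType R).

Lemma initial_cvg (S : choiceType) (T : topologicalType) (f : S -> T)
    (I : Type) (F : set_system I) (u : I -> initial_topology f)
    (s : initial_topology f) : Filter F ->
  (f \o u) @ F --> f s -> u @ F --> s.
Proof.
move=> FF cv A [_ [[B oB <-] Bs sA]].
have : nbhs (f s) B by apply: open_nbhs_nbhs.
move=> /cv FB; rewrite -[u @ F]/(fun C => F (u @^-1` C)).
by apply: (@filterS _ F FF _ _ _ FB) => i Bi; exact: sA.
Qed.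

Lemma weak_star_cvg (I : Type) (F : set_system I) (u : I -> weak_star X)
    (f : weak_star X) : Filter F ->
  (forall x, (u i : dual X) x @[i --> F] --> (f : dual X) x) -> u @ F --> f.
Proof.
move=> FF cv; apply: (@initial_cvg _ _ _ _ F u f FF).
by apply/pointwise_cvgP => x; exact: cv.
Qed.

Lemma weak_star_eval_continuous (x : X) :
  continuous (fun f : weak_star X => (f : dual X) x).
Proof.
move=> f; apply: (@continuous_comp _ {ptws X -> R} _
  (@dual_fun R X : weak_star X -> {ptws X -> R}) (proj x)).
  exact: initial_continuous.
exact: proj_continuous.
Qed.

Definition dual_of (b : dual_ball X) : dual X := \val b.

Lemma dual_of_norm b : `|dual_of b| <= 1.
Proof. by have := valP b; rewrite inE. Qed.

Lemma dual_of_inj : injective dual_of.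
Proof. exact: val_inj. Qed.

Lemma dual_ballE (f : dual X) : `|f| <= 1 -> exists b, dual_of b = f.
Proof.
move=> f1; have fb : (f : weak_star X) \in ([set f | `|f : dual X| <= 1] : set (weak_star X)).
  by rewrite inE.
by exists (SigSub fb).
Qed.

Lemma dual_of_continuous : continuous (dual_of : dual_ball X -> weak_star X).
Proof. exact: initial_continuous. Qed.

Lemma dual_of_eval_continuous x : continuous (fun b => dual_of b x : R).
Proof.
move=> b; apply: (@continuous_comp _ _ _ (dual_of : dual_ball X -> weak_star X)
  (fun f : weak_star X => (f : dual X) x : R)).
  exact: dual_of_continuous.
exact: weak_star_eval_continuous.
Qed.

Lemma dual_ball_cvg (I : Type) (F : set_system I) (u : I -> dual_ball X)
    (b : dual_ball X) : Filter F ->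
  (forall x, dual_of (u i) x @[i --> F] --> (dual_of b x : R)) -> u @ F --> b.
Proof. by move=> FF cv; apply: initial_cvg; exact: weak_star_cvg. Qed.

Lemma dual_norm_le1 (f : dual X) : (forall x, `|f x| <= `|x|) -> `|f| <= 1.
Proof. by move=> fx; apply: dual_norm_le => x x1; exact: le_trans (fx x) x1. Qed.

Lemma dual_of_le (b : dual_ball X) x : `|dual_of b x| <= `|x|.
Proof.
rewrite (le_trans (dual_normP _ _))// ler_piMl//; exact: dual_of_norm.
Qed.

Lemma linear_le_continuous (M : R) (f : X -> R^o) : linear f ->
  (forall x, `|f x| <= M * `|x|) -> continuous f.
Proof.
move=> lf fx.
pose F := HB.pack f (GRing.isLinear.Build R X R^o _ f lf) : {linear X -> R^o}.
apply: (bounded_linear_continuous (f := F)); apply/bounded_funP => r.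
exists (`|M| * r) => x xr; apply: le_trans (fx x) _.
by rewrite (le_trans (ler_norm _))// normrM normr_id ler_wpM2l.
Qed.

Lemma dual_linear_apply (a : R) (f g : dual X) x : (a *: f + g) x = a * f x + g x.
Proof. by []. Qed.

Lemma dual_apply_le (f : dual X) x : `|f x| <= `|f| * `|x|.
Proof. exact: dual_normP. Qed.

Lemma dual_of_exists (f : X -> R^o) : linear f -> (forall x, `|f x| <= `|x|) ->
  exists b, forall x, dual_of b x = f x.
Proof.
move=> lf fx; have fP : f \in @dual_pred R X.
  rewrite inE; split; first exact: lf.
  by apply: (linear_le_continuous (M := 1) lf) => x; rewrite mul1r.
have [b bE] := @dual_ballE (Dual fP) (@dual_norm_le1 (Dual fP) fx).
by exists b => x; rewrite bE.
Qed.

(** Banach-Alaoglu by ultrafilters: the evaluations at each [x] converge along an ultrafilter, and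
    their pointwise limit is again linear and bounded by the norm of [x]. *)
Lemma dual_ball_compact : compact [set: dual_ball X].
Proof.
rewrite compact_ultra => F UF _.
have cv x := ultra_bounded_cvg UF (fun b : dual_ball X => dual_of_le b x).
have [f fE] := choice cv.
have lf : linear (f : X -> R^o).
  move=> a x y; apply: (@cvg_unique _ (@norm_hausdorff R R^o) _ _ _ _ (fE _)).
  rewrite (_ : (fun b => _) = (fun b => a * dual_of b x + dual_of b y)); last first.
    by apply/funext => b; rewrite linearP.
  by apply: cvgD; [apply: cvgMr; exact: fE|exact: fE].
have fx x : `|f x| <= `|x|.
  have /cvg_norm fn := fE x.
  apply: (closed_cvg (fun y : R => y <= `|x|) _ _ _ fn); first exact: closed_le.
  by apply: nearW => b; exact: dual_of_le.
have [b bE] := dual_of_exists lf fx.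
exists b; split=> //; have := @dual_ball_cvg _ F id b _.
by apply=> x; rewrite bE; exact: fE.
Qed.

Lemma dual_ball_hausdorff : hausdorff_space (dual_ball X).
Proof.
move=> a b ab; apply: dual_of_inj; apply/val_inj/funext => x /=.
apply: (@norm_hausdorff R R^o) => A B nA nB.
have nA' := dual_of_eval_continuous nA.
have nB' := dual_of_eval_continuous nB.
by have [c [? ?]] := ab _ _ nA' nB'; exists (dual_of c x).
Qed.

End WeakStarTopology.

(** * Countable tightness and separability *)

Section CountableTightness.
Context (R : realType) (K : topologicalType) (D : Type) (G : K -> D -> R).
Hypothesis G_continuous : forall d, continuous (G ^~ d).

(** Compactness gives the sequence some cluster point in [S]; its coordinates are forced to be the
    limits [G s d], so it is [s]. *)
Lemma cluster_coordinates (S : set K) (a : nat -> K) (s : K) : compact S ->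
  (forall n, S (a n)) -> (forall t, S t -> G t = G s -> t = s) ->
  (forall d, G (a n) d @[n --> \oo] --> G s d) -> cluster (a @ \oo) s.
Proof.
move=> cS Sa inj cv; have [|c [Sc ac]] := cS (a @ \oo) _.
  by exists 0%N => // n _; exact: Sa.
suff <- : c = s by [].
apply: inj => //; apply/funext => d; apply: (@norm_hausdorff R R^o) => A B nA nB.
have nA' := G_continuous nA; have nB' := cv d _ nB.
by have [x [Bx Ax]] := ac (G ^~ d @^-1` B) _ nB' nA'; exists (G x d).
Qed.

Lemma countable_enum (A : set D) : inhabited D -> countable A ->
  exists e : nat -> D, forall d, A d -> exists i, e i = d.
Proof.
move=> [d0] /countable_injP[f finj].
suff H i : exists d, forall d', A d' -> f d' = i -> d = d'.
  by have [e eE] := choice H; exists e => d Ad; exists (f d); exact: eE.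
have [[d [Ad fd]]|nd] := pselect (exists d, A d /\ f d = i).
  by exists d => d' Ad' fd'; apply: finj; rewrite ?inE// fd fd'.
by exists d0 => d' Ad' fd'; case: nd; exists d'.
Qed.

Lemma filter_forall_lt (T : Type) (F : set_system T) (P : nat -> set T) n :
  Filter F -> (forall i, F (P i)) ->
  F [set x | forall i, (i < n)%N -> P i x].
Proof.
move=> FF FP; elim: n => [|n IHn]; first exact: nearW.
apply: filterS2 IHn (FP n) => x Px Pnx i.
by rewrite ltnS leq_eqVlt => /predU1P[->//|]; exact: Px.
Qed.

(** The diagonal argument for Corson compacta: the n-th point agrees with [s] up to 1/(n+1) on the
    first n support coordinates of [s] and of each earlier point. Coordinates in one of these
    supports then converge; all others vanish at [s] and along the whole sequence. *)
Lemma countable_tightness (A : set K) (s : K) : compact [set: K] ->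
  inhabited D -> injective G -> (forall k, countable [set d | G k d != 0]) ->
  closure A s ->
  exists a : nat -> K, (forall n, A (a n)) /\ cluster (a @ \oo) s.
Proof.
move=> cK D0 Ginj Gc As.
have [e eP] := choice (fun k => countable_enum D0 (Gc k)).
(* [h] lists the points chosen so far and [e t k] is the k-th support coordinate of [t]. Entry 0 of
   [s :: h] is [s] itself, hence one more index than [size h]. *)
have pickP (h : seq K) : exists a, A a /\
    forall i k, (i < (size h).+1)%N -> (k < size h)%N ->
    `|G s (e (nth s (s :: h) i) k) - G a (e (nth s (s :: h) i) k)|
      < (size h).+1%:R^-1.
  have [|a [? aP]] := As [set a | forall i, (i < (size h).+1)%N -> forall k,
      (k < size h)%N ->
      `|G s (e (nth s (s :: h) i) k) - G a (e (nth s (s :: h) i) k)|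
        < (size h).+1%:R^-1]; last by exists a; split=> // i k /aP; exact.
  apply: filter_forall_lt => i; apply: filter_forall_lt => k.
  set d := e _ k; have := @G_continuous d s => /cvgrPdist_lt; apply.
  by rewrite invr_gt0.
have [p pP] := choice pickP.
pose h := fix h n := if n is m.+1 then rcons (h m) (p (h m)) else [::].
pose a n := p (h n).
have hE n : h n = mkseq a n.
  by elim: n => // n IHn; rewrite mkseqS -IHn.
exists a; split=> [n|]; first exact: (pP _).1.
apply: (@cluster_coordinates setT) => // [t _|d]; first exact: Ginj.
(* Once [t] is in the list, its support coordinate [d] is controlled at every late stage. *)
have key t i : (forall n, (i < n)%N -> exists2 j, (j < n.+1)%N &
    nth s (s :: h n) j = t) -> G t d != 0 -> G (a n) d @[n --> \oo] --> G s d.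
  move=> tn /eP[k kd]; apply/cvgrPdist_lt => _/posnumP[eps].
  near=> n.
  have [|j jn jt] := tn n; first by near: n; exact: nbhs_infty_gt.
  have := (pP (h n)).2 j k; rewrite jt kd hE size_mkseq => /(_ jn) H.
  rewrite /a hE (lt_trans (H _))//; first by near: n; exact: nbhs_infty_gt.
  by near: n; exact: near_infty_natSinv_lt.
have [sd|sd] := eqVneq (G s d) 0; last first.
  by apply: (key s 0%N) => // n _; exists 0%N.
have [[i]|nd] := pselect (exists i, G (a i) d != 0).
  apply: (key (a i) i) => n ni; exists i.+1; rewrite //= hE nth_mkseq//.
rewrite sd (_ : (fun n => _) = cst 0); first exact: cvg_cst.
by apply/funext => n /=; apply: contrapT => /eqP ?; apply: nd; exists n.
Unshelve. all: by end_near. Qed.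

End CountableTightness.

Lemma rat_near (R : realType) (x e : R) : 0 < e ->
  exists q : rat, `|x - ratr q| < e.
Proof.
move=> e0; have [q] := @rat_in_itvoo R (x - e) (x + e) ltac:(lra).
rewrite in_itv/= => /andP[q1 q2]; exists q; rewrite ltr_norml; lra.
Qed.

(** One point of [S] is picked in each nonempty box with rational centre. Boxes shrinking around the
    coordinates of [s] yield picked points whose coordinates converge to those of [s], so they
    cluster at [s] by compactness. *)
Lemma compact_separable (R : realType) (K : topologicalType)
    (G : K -> nat -> R) (S : set K) : (forall i, continuous (G ^~ i)) ->
  compact S -> (forall s t, S s -> S t -> G s = G t -> s = t) ->
  separable_set S.
Proof.
move=> Gc cS Ginj.
have [[s0 Ss0]|S0] := pselect (exists s, S s); last first.
  by exists set0; split=> // x Sx; case: S0; exists x.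
(* The radius is tied to the length of [v], so that finite rational sequences alone index the
   boxes. *)
pose box (v : seq rat) s := S s /\ forall i, (i < size v)%N ->
  `|G s i - ratr (nth 0 v i)| < (size v).+1%:R^-1.
have pickP (v : seq rat) : exists s, S s /\ ((exists t, box v t) -> box v s).
  have [[t vt]|nt] := pselect (exists t, box v t).
    by exists t; split=> //; exact: vt.1.
  by exists s0; split=> // /nt.
have [p pP] := choice pickP.
exists (range p); split.
- exact: (sub_countable (card_image_le _ _)).
- by move=> _ [v _ <-]; exact: (pP v).1.
move=> s Ss.
have ratP n : exists f : nat -> rat, forall i, `|G s i - ratr (f i)| < n.+1%:R^-1.
  have n0 : 0 < n.+1%:R^-1 :> R by rewrite invr_gt0.
  by have [f fP] := choice (fun i => rat_near (G s i) n0); exists f.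
have [f fP] := choice ratP.
pose a n := p (mkseq (f n) n).
suff : cluster (a @ \oo) s.
  move=> as_ U /(as_ (range p) U); apply.
  by exists 0%N => // n _; exists (mkseq (f n) n).
apply: (cluster_coordinates Gc cS) => [n|t St|i].
- exact: (pP _).1.
- by apply: Ginj.
apply/cvgrPdist_lt => _/posnumP[eps]; near=> n.
have [|Sa aP] := (pP (mkseq (f n) n)).2.
  exists s; split=> // j; rewrite size_mkseq => jn; rewrite nth_mkseq//.
have ni : (i < n)%N by near: n; exact: nbhs_infty_gt.
have := aP i; rewrite size_mkseq nth_mkseq// => /(_ ni) H1.
have H2 := fP n i.
have H3 : n.+1%:R^-1 < eps%:num / 2.
  by near: n; exact: (near_infty_natSinv_lt (eps%:num / 2)%:pos).
rewrite (splitr eps%:num) (le_lt_trans (ler_distD (ratr (f n i)) _ _))//.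
by rewrite ltrD// (lt_trans _ H3)// distrC.
Unshelve. all: by end_near. Qed.

(** * Regularisation of a finitely additive probability *)

Section ContentMeasure.
Context (R : realType) (K : ptopologicalType) (nu : set K -> R).
Hypothesis (hK : hausdorff_space K) (cK : compact [set: K]).
Hypothesis (nu_ge0 : forall A, 0 <= nu A) (nuT : nu setT = 1).
Hypothesis nuU : forall A B, A `&` B = set0 -> nu (A `|` B) = nu A + nu B.
Local Open Scope ereal_scope.

Let nu0 : nu set0 = 0%R.
Proof.
by have := nuU (setI0 (@set0 K)); rewrite setU0 => /esym/eqP; rewrite addrC -subr_eq0 addrK => /eqP.
Qed.

Let le_nu A B : A `<=` B -> (nu A <= nu B)%R.
Proof.
move=> AB; have -> : B = A `|` (B `\` A) by rewrite setDUK.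
by rewrite nuU ?lerDl//; apply/seteqP; split=> // x [? []].
Qed.

Let nuU_le A B : (nu (A `|` B) <= nu A + nu B)%R.
Proof.
have -> : A `|` B = A `|` (B `\` A) by rewrite setUDr setDv setD0.
rewrite nuU; first by rewrite lerD2l; apply: le_nu; exact: subDsetl.
by apply/seteqP; split=> // x [? []].
Qed.

(** [nu] is only finitely additive. Measuring open sets from inside by closed sets, then all sets
    from outside by open sets, is the usual passage from a content to a Radon measure; compactness
    supplies countable subadditivity. *)
Definition inner_content (U : set K) : \bar R :=
  ereal_sup [set (nu C)%:E | C in [set C | closed C /\ C `<=` U]].

Definition outer_content (A : set K) : \bar R :=
  ereal_inf [set inner_content U | U in [set U | open U /\ A `<=` U]].

Local Notation inn := inner_content.
Local Notation out := outer_content.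

Let inn_ge C U : closed C -> C `<=` U -> (nu C)%:E <= inn U.
Proof. by move=> cC CU; apply: ereal_sup_ubound; exists C. Qed.

Let inn_le U M : (forall C, closed C -> C `<=` U -> (nu C)%:E <= M) ->
  inn U <= M.
Proof. by move=> CM; apply: ge_ereal_sup => _ [C [cC CU] <-]; exact: CM. Qed.

Let inn_ge0 U : 0 <= inn U.
Proof. by have := inn_ge closed0 (@sub0set _ U); rewrite nu0. Qed.

Let inn_le1 U : inn U <= 1.
Proof. by apply: inn_le => C _ _; rewrite lee_fin -nuT; exact: le_nu. Qed.

Let le_inn U V : U `<=` V -> inn U <= inn V.
Proof. by move=> UV; apply: inn_le => C cC CU; apply: inn_ge => // x /CU/UV. Qed.

(** For closed [C] in the union, normality gives [W] around C minus V with closure inside [U]. The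
    part of [C] in the closure of [W] lies in [U], the part outside the interior of [W] lies in [V],
    and both are closed. *)
Let innU U V : open U -> open V -> inn (U `|` V) <= inn U + inn V.
Proof.
move=> oU oV; apply: inn_le => C cC CUV.
have cA : closed (C `\` V) by apply: closedI => //; exact: open_closedC.
have [|W AW WU] := compact_normal hK cK cA (t := U).
  by move=> x [Cx Vx]; apply: open_nbhs_nbhs; split=> //; have [] := CUV _ Cx.
apply: (@le_trans _ _ ((nu (C `&` closure W) + nu (C `&` ~` W^°))%R)%:E).
  rewrite lee_fin (le_trans _ (nuU_le _ _))//; apply: le_nu => x Cx.
  have [Wx|Wx] := pselect (W^° x); last by right.
  by left; split=> //; apply: subset_closure; exact: interior_subset.
rewrite EFinD leeD//.
  by apply: inn_ge => [|x [_ /WU]//]; apply: closedI => //; exact: closed_closure.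
apply: inn_ge; first by apply: closedI => //; apply: open_closedC; exact: open_interior.
by move=> x [Cx Wx]; apply: contrapT => Vx; apply: Wx; exact: AW.
Qed.

Let inn0 : inn set0 = 0.
Proof.
apply/eqP; rewrite eq_le inn_ge0 andbT; apply: inn_le => C _.
by rewrite subset0 => ->; rewrite nu0.
Qed.

Let inn_bigsetU (U : nat -> set K) n : (forall i, open (U i)) ->
  inn (\big[setU/set0]_(i < n) U i) <= \sum_(i < n) inn (U i).
Proof.
move=> oU; elim: n => [|n IHn]; first by rewrite !big_ord0 inn0.
rewrite !big_ord_recr/= (le_trans (innU _ _))//; last by rewrite leeD2r.
by rewrite -bigcup_mkord; apply: bigcup_open.
Qed.

(** A closed set inside the union is compact, so finitely many of the [U i] already cover it. *)
Let inn_bigcup (U : nat -> set K) : (forall i, open (U i)) ->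
  inn (\bigcup_i U i) <= \sum_(i <oo) inn (U i).
Proof.
move=> oU; apply: inn_le => C cC CU.
have : compact C by exact: (subclosed_compact cC cK).
rewrite compact_cover => /(_ nat setT U (fun i _ => oU i) CU)[D _ DU].
pose n := (\max_(i <- finmap.enum_fset D) i).+1.
apply: (@le_trans _ _ (inn (\big[setU/set0]_(i < n) U i))).
  apply: inn_ge => // x /DU[i /= iD Uix]; rewrite -bigcup_mkord.
  by exists i => //=; rewrite /n ltnS; exact: leq_bigmax_seq.
apply: le_trans (inn_bigsetU _ oU) _.
rewrite -(big_mkord xpredT (fun i => inn (U i))).
by apply: nneseries_lim_ge => i _ _; exact: inn_ge0.
Qed.

Let out_ge0 A : 0 <= out A.
Proof. by apply: le_ereal_inf_tmp => _ [U _ <-]; exact: inn_ge0. Qed.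

Let out_le A U : open U -> A `<=` U -> out A <= inn U.
Proof. by move=> oU AU; apply: ereal_inf_lbound; exists U. Qed.

Let out_open U : open U -> out U = inn U.
Proof.
move=> oU; apply/eqP; rewrite eq_le out_le//=.
by apply: le_ereal_inf_tmp => _ [V [_ UV] <-]; exact: le_inn.
Qed.

Let out_fin A : out A \is a fin_num.
Proof.
rewrite ge0_fin_numE//; apply: le_lt_trans (ltry 1%R).
by rewrite (le_trans (out_le openT _))//.
Qed.

Let le_out : {homo out : A B / A `<=` B >-> A <= B}.
Proof.
move=> A B AB; apply: le_ereal_inf_tmp => _ [U [oU BU] <-].
by apply: out_le => // x /AB/BU.
Qed.

Let out0 : out set0 = 0.
Proof. by rewrite out_open ?inn0//; exact: open0. Qed.

Let out_adherent A (e : R) : (0 < e)%R ->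
  exists U, [/\ open U, A `<=` U & inn U <= out A + e%:E].
Proof.
move=> e0; have [_ [U [oU AU] <-] /ltW h] := lb_ereal_inf_adherent e0 (out_fin A).
by exists U.
Qed.

Let out_subadditive : sigma_subadditive out.
Proof.
move=> A; apply/lee_addgt0Pr => e e0.
have ei i : (0 < e / (2 ^ i.+1)%:R)%R by rewrite divr_gt0// ltr0n expn_gt0.
have [U UP] := choice (fun i => out_adherent (A i) (ei i)).
apply: (@le_trans _ _ (inn (\bigcup_i U i))).
  apply: out_le; first by apply: bigcup_open => i _; have [] := UP i.
  by apply: subset_bigcup => i _; have [] := UP i.
apply: le_trans (inn_bigcup _) _; first by move=> i; have [] := UP i.
apply: le_trans (epsilon_trick xpredT (fun i => out_ge0 (A i)) (ltW e0)).
apply: lee_nneseries => [i _ _|i _]; first exact: inn_ge0.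
by have [] := UP i.
Qed.

Let outer : {outer_measure set K -> \bar R} :=
  HB.pack_for {outer_measure set K -> \bar R} out
    (isOuterMeasure.Build R K out out0 out_ge0 le_out out_subadditive).

(** For open [V] containing [X], take a closed [C] inside the part of [V] in [U], then a closed [D]
    inside V minus C, an open set containing the part of [X] off [U]. As [C] and [D] are disjoint,
    [nu C + nu D] is at most the content of [V]. *)
Let caratheodory_open U : open U -> outer.-caratheodory U.
Proof.
move=> oU; apply: le_caratheodory_measurable => X /=.
apply: le_ereal_inf_tmp => _ [V [oV XV] <-].
rewrite -leeBrDr ?out_fin//.
apply: (@le_trans _ _ (inn (V `&` U))).
  by apply: out_le; [exact: openI|exact: setSI].
apply: inn_le => C cC CVU; rewrite leeBrDr ?out_fin//.
apply: (@le_trans _ _ ((nu C)%:E + inn (V `\` C))).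
  rewrite leeD2l//; apply: out_le.
    by apply: openI => //; exact: closed_openC.
  by move=> x [/XV Vx Ux]; split=> // /CVU[].
rewrite -leeBrDl//; apply: inn_le => D cD DVC; rewrite leeBrDl//.
rewrite -EFinD -nuU; last first.
  by apply/seteqP; split=> // x [Cx /DVC[]].
by apply: inn_ge; [exact: closedU|move=> x [/CVU[]|/DVC[]]].
Qed.

Let caratheodory_borel (A : set (borel K)) : measurable A -> outer.-caratheodory A.
Proof.
apply: smallest_sub.
  exact: (sigma_algebra_measurable (caratheodory_type outer)).
exact: caratheodory_open.
Qed.

(** [nu C] is below the content of every open set around a closed [C]. The resulting one-sided bound
    is what carries positive mass from [nu] to [P]. *)
Lemma regular_extension : exists P : probability (borel K) R,
  regular_measure P /\ forall C : set K, closed C -> (nu C)%:E <= P C.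
Proof.
have sa : semi_sigma_additive (out : set (borel K) -> \bar R).
  move=> F mF tF mUF; apply: (@caratheodory_measure_sigma_additive _ K outer) => //.
    by move=> i; exact: caratheodory_borel.
  exact: caratheodory_borel.
pose mm := isMeasure.Build _ (borel K) R out out0 out_ge0 sa.
pose m : {measure set (borel K) -> \bar R} :=
  HB.pack_for {measure set (borel K) -> \bar R}
    (out : set (borel K) -> \bar R) mm.
have m1 : m setT = 1.
  apply/eqP; rewrite eq_le [m _]out_open; last exact: openT.
  by rewrite inn_le1/= -nuT inn_ge//; exact: closedT.
pose P : probability (borel K) R :=
  HB.pack_for (probability (borel K) R) (out : set (borel K) -> \bar R) mm
  (Measure_isProbability.Build _ (borel K) R m m1).
have mopen (U : set K) : open U -> measurable (U : set (borel K)).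
  by move=> oU; exact: sub_sigma_algebra.
have PE (A : set K) : P A = out A by [].
have nuP (C : set K) : closed C -> (nu C)%:E <= P C.
  by move=> cC; apply: le_ereal_inf_tmp => _ [U [_ CU] <-]; exact: inn_ge.
exists P; split=> // A mA; split.
  apply/eqP; rewrite eq_le; apply/andP; split.
    by apply: le_ereal_inf_tmp => _ [U [oU AU] <-]; rewrite !PE le_out.
  apply: le_ereal_inf_tmp => _ [U [oU AU] <-]; apply: ereal_inf_lbound.
  by exists U => //; rewrite PE out_open.
apply/eqP; rewrite eq_le; apply/andP; split; last first.
  by apply: ge_ereal_sup => _ [C [_ _ CA] <-]; rewrite !PE le_out.
(* Inner regularity of [A] is outer regularity of its complement: if an open [U] around the
   complement is optimal up to [e], the complement of [U] is a compact subset of [A] missing at most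
   [e] of its mass. *)
apply/lee_addgt0Pr => e e0.
have [U [oU AU Ue]] := out_adherent (~` A) e0.
have PC B : measurable (B : set (borel K)) -> P B = 1 - P (~` B).
  move=> mB; rewrite -[in RHS](setCK B) -probability_setC ?setCK//.
  exact: measurableC.
apply: (@le_trans _ _ (P (~` U) + e%:E)); last first.
  rewrite leeD2r//; apply: ereal_sup_ubound; exists (~` U) => //; split.
  - exact: (subclosed_compact (open_closedC oU) cK).
  - exact: open_closedC.
  - by move=> x Ux; apply: contrapT => /AU.
rewrite (PC A)// (PC (~` U)); last by apply: measurableC; exact: mopen.
rewrite setCK (PE U) (out_open oU) PE.
have fU : inn U \is a fin_num by rewrite -out_open.
move: Ue; rewrite -(fineK fU) -(fineK (out_fin (~` A))).
rewrite -!(EFinD, EFinB) !lee_fin; lra.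
Qed.

End ContentMeasure.

(** * Bounded measurable functions and elementary tensors *)

Section BoundedMeasurable.
Context d (T : measurableType d) (R : realType).
Implicit Types h : T -> R.

Definition bounded_measurable h : Prop :=
  measurable_fun setT h /\ exists M, forall t, `|h t| <= M.

Local Notation bm := bounded_measurable.

Lemma bmD h k : bm h -> bm k -> bm (h \+ k).
Proof.
move=> [mh [M hM]] [mk [N kN]]; split; first exact: measurable_funD.
by exists (M + N) => t; rewrite (le_trans (ler_normD _ _))// lerD.
Qed.

Lemma bmM h k : bm h -> bm k -> bm (h \* k).
Proof.
move=> [mh [M hM]] [mk [N kN]]; split; first exact: measurable_funM.
by exists (M * N) => t; rewrite normrM ler_pM.
Qed.

Lemma bm_cst a : bm (cst a).
Proof. by split=> //; exists `|a|. Qed.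

Lemma bmZ a h : bm h -> bm (fun t => a * h t).
Proof. by move=> bh; exact: (bmM (bm_cst a) bh). Qed.

Lemma bmN h : bm h -> bm (fun t => - h t).
Proof.
move=> /(bmZ (-1)); rewrite (_ : (fun t => _) = (fun t => - h t))//.
by apply/funext => t; rewrite mulN1r.
Qed.

Lemma bm_sum n (h : nat -> T -> R) : (forall i, bm (h i)) ->
  bm (fun t => \sum_(i < n) h i t).
Proof.
move=> bh; elim: n => [|n IHn].
  rewrite (_ : (fun t => _) = cst 0); first exact: bm_cst.
  by apply/funext => t; rewrite big_ord0.
rewrite (_ : (fun t => _) = (fun t => \sum_(i < n) h i t) \+ h n).
  exact: bmD.
by apply/funext => t; rewrite big_ord_recr.
Qed.

Lemma bm_indic (A : set T) : measurable A -> bm \1_A.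
Proof.
move=> mA; split; first exact: measurable_indic.
by exists 1 => t; rewrite indicE; case: (_ \in _); rewrite ?normr1 ?normr0.
Qed.

Lemma bm_norm h : bm h -> bm (fun t => `|h t|).
Proof.
move=> [mh [M hM]]; split; first exact: measurableT_comp.
by exists M => t; rewrite normr_id.
Qed.

Lemma bm_simple h : simple_fun h -> bm h.
Proof.
move=> sh; split; first exact: simple_measurable.
exists (\sum_(y <- finmap.enum_fset (fset_set (range h))) `|y|) => t.
rewrite (bigD1_seq (h t)) ?finmap.fset_uniq//=; first by rewrite lerDl sumr_ge0.
by rewrite in_fset_set ?inE; [exists t|exact: sh.1].
Qed.

Context (mu : {finite_measure set T -> \bar R}).

Lemma bm_integrable h : bm h -> mu.-integrable setT (EFin \o h).
Proof.
move=> [mh [M hM]]; apply: measurable_bounded_integrable => //.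
  by rewrite -ge0_fin_numE//; exact: fin_num_measure.
by exists M; split; [exact: num_real|move=> x Mx t _; exact: le_trans (hM t) (ltW Mx)].
Qed.

End BoundedMeasurable.

Import HBSimple.

Section Tensor.
Context d (T : measurableType d) (R : realType).
Context (mu : {finite_measure set T -> \bar R}) (Y : completeNormedModType R).
Local Notation X := (L1 mu Y).
Local Notation bm := (@bounded_measurable _ T R).
Local Open Scope quotient_scope.
Implicit Types (f g : T -> Y) (h k : T -> R) (y : Y).

(** Totalised: a function that is not Bochner integrable goes to the class of 0, so that tensors can
    be written without a proof of integrability. *)
Definition integrable_class f : X := \pi_X (insubd (0 : bochner mu Y) f).
Local Notation cls := integrable_class.
Local Notation bochnerf := (@bochner_pred _ _ _ mu Y).

Lemma class_val (f : bochner mu Y) : cls f = \pi_X f.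
Proof. by rewrite /cls valKd. Qed.

Lemma classE f : f \in bochnerf -> exists2 F : bochner mu Y,
  f = F :> (T -> Y) & cls f = \pi_X F.
Proof. by move=> fP; exists (Bochner fP) => //; rewrite -class_val. Qed.

Lemma class_linear a f g : f \in bochnerf -> g \in bochnerf ->
  cls (fun t => a *: f t + g t) = a *: cls f + cls g.
Proof.
move=> /classE[F -> ->] /classE[G -> ->].
by rewrite [_ *: _]L1_piZ -L1_piD -class_val.
Qed.

Lemma norm_class f : f \in bochnerf -> (`|cls f|)%:E = int_norm mu f.
Proof.
by move=> /classE[F -> ->]; rewrite [`|_|]L1_norm_pi fineK// bochner_fin.
Qed.

Definition tensor h y : X := cls (fun t => h t *: y).

Lemma tensor_bochner h y : bm h -> (fun t => h t *: y) \in bochnerf.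
Proof.
move=> [mh [M hM]]; rewrite inE; split.
  have /measurable_EFinP mEh := mh.
  have [s sh] := approximation_sfun measurableT mEh.
  exists (fun n t => s n t *: y); split=> [n|].
    apply: (simple_comp (fun a => a *: y)); split=> [|a]; first exact: fimfunP.
    exact: measurable_sfunP.
  apply: aeW => t; apply: cvgZr_tmp.
  exact: fine_cvg (sh t I).
have bn : bm (fun t => `|h t| * `|y|).
  by apply: bmM; [apply: bm_norm; split=> //; exists M|exact: bm_cst].
have /integrableP[_] := bm_integrable mu bn.
rewrite (eq_integral (fun t => (`|h t *: y|)%:E))// => t _.
by rewrite gee0_abs ?lee_fin ?mulr_ge0//= normrZ.
Qed.

Lemma tensorDl h k y : bm h -> bm k ->
  tensor (h \+ k) y = tensor h y + tensor k y.
Proof.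
move=> bh bk; rewrite -[tensor h y]scale1r.
rewrite -class_linear ?tensor_bochner//; congr cls; apply/funext => t.
by rewrite scale1r scalerDl.
Qed.

Lemma tensorZl a h y : bm h -> tensor (fun t => a * h t) y = a *: tensor h y.
Proof.
move=> bh; have b0 : bm (cst 0) by exact: bm_cst.
rewrite (_ : a *: _ = a *: tensor h y + tensor (cst 0) y); last first.
  rewrite -[in RHS](addrK (tensor (cst 0) y) (tensor (cst 0) y)) -tensorDl//.
  rewrite (_ : cst 0 \+ cst 0 = cst 0) ?subrr ?addr0//.
  by apply/funext => t /=; rewrite addr0.
rewrite -class_linear ?tensor_bochner//; congr cls; apply/funext => t.
by rewrite scale0r addr0 scalerA.
Qed.

Lemma tensorP h a y z : bm h ->
  tensor h (a *: y + z) = a *: tensor h y + tensor h z.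
Proof.
move=> bh; rewrite -class_linear ?tensor_bochner//; congr cls.
by apply/funext => t; rewrite scalerDr !scalerA mulrC.
Qed.

Lemma norm_tensor h y : bm h -> `|tensor h y| = (\int[mu]_t `|h t|) * `|y|.
Proof.
move=> bh; apply/EFin_inj; rewrite norm_class ?tensor_bochner//.
have ih : mu.-integrable setT (EFin \o (fun t => `|h t|)).
  by apply: bm_integrable; exact: bm_norm.
rewrite -RintegralZr// fineK; first by apply: eq_integral => t _; rewrite normrZ.
apply: integrable_fin_num => //; apply: bm_integrable.
by apply: (bmM (bm_norm bh)); exact: bm_cst.
Qed.

Lemma simple_bounded (p : T -> nat) : simple_fun p -> exists n, forall t, (p t < n)%N.
Proof.
move=> [fp _]; exists (\max_(i <- finmap.enum_fset (fset_set (range p))) i).+1 => t.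
by rewrite ltnS; apply: leq_bigmax_seq => //; rewrite in_fset_set// inE; exists t.
Qed.

(** A finite measurable partition is encoded by a simple labelling [p : T -> nat] whose fibres are
    the blocks; a field constant on the blocks is then [g \o p]. *)
Lemma tensor_sum (p : T -> nat) (g : nat -> Y) n : simple_fun p ->
  (forall t, (p t < n)%N) ->
  cls (g \o p) = \sum_(k < n) tensor \1_(p @^-1` [set nat_of_ord k]) (g k).
Proof.
move=> sp pn.
have bp (k : nat) : bm \1_(p @^-1` [set k]) by apply: bm_indic; exact: sp.2.
rewrite (_ : g \o p =
    fun t => \sum_(k < n) \1_(p @^-1` [set nat_of_ord k]) t *: g k); last first.
  apply/funext => t; rewrite (bigD1 (Ordinal (pn t)))//= big1 ?addr0.
    by rewrite indicE mem_set// scale1r.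
  move=> k kt; rewrite indicE memNset ?scale0r//= => ptk.
  by move: kt; rewrite -val_eqE/= ptk eqxx.
have sump m : (fun t => \sum_(k < m) \1_(p @^-1` [set nat_of_ord k]) t *: g k)
    \in bochnerf /\ cls (fun t => \sum_(k < m)
    \1_(p @^-1` [set nat_of_ord k]) t *: g k) =
    \sum_(k < m) tensor \1_(p @^-1` [set nat_of_ord k]) (g k).
  elim: m => [|m [IH1 IH2]].
    rewrite big_ord0 (_ : (fun t => _) = ((0 : bochner mu Y) : T -> Y)); last first.
      by apply/funext => t; rewrite big_ord0.
    split; first exact: bochnerP.
    by rewrite class_val; apply: (addrI (\pi_X 0)); rewrite addr0 -L1_piD addr0.
  rewrite big_ord_recr/= -IH2 -[X in X + _]scale1r -class_linear ?tensor_bochner//.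
  rewrite (_ : (fun t => _) = (fun t => 1 *: (\sum_(k < m)
      \1_(p @^-1` [set nat_of_ord k]) t *: g k) +
      \1_(p @^-1` [set m]) t *: g m)); last first.
    by apply/funext => t; rewrite big_ord_recr/= scale1r.
  split=> //.
  have := @bochner_submod_closed _ _ _ mu Y.
  by move=> [_]; apply=> //; exact: tensor_bochner.
exact: (sump n).2.
Qed.

End Tensor.

(** * Functionals on the Lebesgue-Bochner space *)

Section Pull.
Context d (T : measurableType d) (R : realType).
Context (mu : {finite_measure set T -> \bar R}) (Y : completeNormedModType R).
Local Notation X := (L1 mu Y).
Local Notation bm := (@bounded_measurable _ T R).
Implicit Types (h k : T -> R) (y : Y) (phi : dual X).

(** The default 0 is taken only if the map in [y] is not a continuous functional, which does not
    occur for bounded measurable [h], as the proof of [pullE] shows. *)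
Definition pull phi h : dual Y :=
  insubd (0 : dual Y) (fun y => phi (tensor mu h y) : R^o).

Lemma pullE phi h y : bm h -> pull phi h y = phi (tensor mu h y).
Proof.
move=> bh; have P : (fun y => phi (tensor mu h y) : R^o) \in @dual_pred R Y.
  have lf : linear (fun y => phi (tensor mu h y) : R^o).
    by move=> a u v; rewrite tensorP// linearP.
  rewrite inE; split; first exact: lf.
  apply: (linear_le_continuous (M := `|phi| * \int[mu]_t `|h t|) lf) => u.
  by rewrite (le_trans (dual_apply_le _ _))// norm_tensor// mulrA.
have E : val (pull phi h) = (fun y => phi (tensor mu h y) : R^o) := insubdK _ P.
exact: (congr1 (fun f => f y) E).
Qed.

Lemma dual_ext (V : normedModType R) (f g : dual V) : f =1 g -> f = g.
Proof. by move=> fg; apply/val_inj/funext. Qed.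

Lemma pull_linear a phi psi h : bm h ->
  pull (a *: phi + psi) h = a *: pull phi h + pull psi h.
Proof. by move=> bh; apply: dual_ext => y; rewrite dual_linear_apply !pullE. Qed.

Lemma pullD phi h k : bm h -> bm k -> pull phi (h \+ k) = pull phi h + pull phi k.
Proof.
move=> bh bk; apply: dual_ext => y; have bhk := bmD bh bk.
by rewrite -[pull phi h]scale1r dual_linear_apply !pullE// tensorDl// linearD mul1r.
Qed.

Lemma pullZ phi a h : bm h -> pull phi (fun t => a * h t) = a *: pull phi h.
Proof.
move=> bh; apply: dual_ext => y; have bah := bmZ a bh.
by rewrite -[a *: pull phi h]addr0 dual_linear_apply !pullE// tensorZl// linearZ addr0.
Qed.

Lemma pull_le phi h y : bm h ->
  `|pull phi h y| <= `|phi| * (\int[mu]_t `|h t|) * `|y|.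
Proof.
by move=> bh; rewrite pullE// (le_trans (dual_apply_le _ _))// norm_tensor// mulrA.
Qed.

Lemma norm_pull_le phi h : bm h -> `|pull phi h| <= `|phi| * (\int[mu]_t `|h t|).
Proof.
move=> bh; have i0 : 0 <= \int[mu]_t `|h t| by apply: Rintegral_ge0.
apply: dual_norm_le => y y1; apply: le_trans (pull_le _ _ bh) _.
by rewrite ler_piMr// mulr_ge0.
Qed.

Lemma pull_simple_class phi psi (p : T -> nat) (g : nat -> Y) : simple_fun p ->
  (forall k : nat, pull phi \1_(p @^-1` [set k]) = pull psi \1_(p @^-1` [set k])) ->
  phi (integrable_class mu (g \o p)) = psi (integrable_class mu (g \o p)).
Proof.
move=> sp pq; have [n pn] := simple_bounded sp.
rewrite (tensor_sum mu g sp pn) !linear_sum; apply: eq_bigr => k _.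
have bk : bm \1_(p @^-1` [set nat_of_ord k]) by apply: bm_indic; exact: sp.2.
by have := congr1 (fun f : dual Y => f (g k)) (pq k); rewrite !pullE.
Qed.

Lemma simple_factor (V : pointedType) (s : T -> V) : simple_fun s ->
  exists (p : T -> nat) (g : nat -> V), simple_fun p /\ s = g \o p.
Proof.
move=> ss; have /finite_set_countable/countable_injP[f finj] := ss.1.
have [e eP] := countable_enum (inhabits (point : V)) (finite_set_countable ss.1).
have H v : exists n, range s v -> e n = v.
  have [/eP[n <-]|nv] := pselect (range s v); first by exists n.
  by exists 0%N.
have [r rP] := choice H.
exists (r \o s), e; split; first exact: simple_comp.
by apply/funext => t /=; rewrite rP//; exists t.
Qed.

Lemma simple_class_dense (q : X) (e : R) : 0 < e ->
  exists (p : T -> nat) (g : nat -> Y), simple_fun p /\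
    `|integrable_class mu (g \o p) - q| < e.
Proof.
move=> e0; have [f [sf]] := simple_dense (repr q) e0.
rewrite reprK => fq.
have [p [g [sp fE]]] := simple_factor (V := Y) sf.
by exists p, g; split=> //; rewrite -fE class_val.
Qed.

(** Simple fields are sums of tensors of indicators and are dense, so bounded functionals agreeing
    on these tensors coincide. *)
Lemma pull_inj phi psi :
  (forall A, measurable A -> pull phi \1_A = pull psi \1_A) -> phi = psi.
Proof.
move=> pq; apply: dual_ext => q; apply/eqP; rewrite -subr_eq0 -normr_le0.
apply/ler_addgt0Pr => e e0; rewrite add0r.
have N0 : 0 < `|phi| + `|psi| + 1 by rewrite ltr_wpDl.
have [p [g [sp pgq]]] := simple_class_dense q (divr_gt0 e0 N0).
have E : phi (integrable_class mu (g \o p)) = psi (integrable_class mu (g \o p)).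
  by apply: pull_simple_class => // k; apply: pq; exact: sp.2.
set c := integrable_class _ _ in pgq E.
rewrite (_ : _ - _ = psi (c - q) - phi (c - q)); last first.
  have H1 : phi (c - q) = phi c - phi q := linearB phi c q.
  have H2 : psi (c - q) = psi c - psi q := linearB psi c q.
  by rewrite H1 H2 E opprB [RHS]addrC addrA subrK.
apply: le_trans (ler_normB _ _) _.
rewrite (le_trans (lerD (dual_apply_le _ _) (dual_apply_le _ _)))//.
rewrite -mulrDl addrC; move: pgq; rewrite ltr_pdivlMr// => /ltW; apply: le_trans.
by rewrite mulrC ler_wpM2l// lerDl.
Qed.

End Pull.

(** * Densities of bounded functionals *)

Section ScalarFunctionals.
Context d (T : measurableType d) (R : realType).
Context (mu : {finite_measure set T -> \bar R}).
Local Notation bm := (@bounded_measurable _ T R).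
Local Notation int f := (mu.-integrable setT (EFin \o f)).
Local Notation I f := (\int[mu]_t f t).
Implicit Types (f g h k : T -> R).

Lemma bm_integralD h k : bm h -> bm k -> I (h \+ k) = I h + I k.
Proof. by move=> bh bk; rewrite RintegralD//; exact: bm_integrable. Qed.

Lemma bm_integralZ a h : bm h -> \int[mu]_t (a * h t) = a * I h.
Proof. by move=> bh; rewrite RintegralZl//; exact: bm_integrable. Qed.

Lemma bm_integral_sum n (h : nat -> T -> R) : (forall i, bm (h i)) ->
  \int[mu]_t (\sum_(i < n) h i t) = \sum_(i < n) I (h i).
Proof.
move=> bh; elim: n => [|n IHn].
  rewrite big_ord0 (@eq_Rintegral _ _ _ mu setT (cst 0)) ?Rintegral_cst ?mul0r//.
  by move=> t _; rewrite big_ord0.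
rewrite big_ord_recr/= -IHn -bm_integralD//; last exact: bm_sum.
by apply: eq_Rintegral => t _; rewrite big_ord_recr.
Qed.

(** An element of the dual of the scalar space L1(mu), known through bounded functions only: the
    bound is by the L1 norm, not the sup norm. *)
Record bounded_functional (psi : (T -> R) -> R) (C : R) : Prop := {
  bfD : forall h k, bm h -> bm k -> psi (h \+ k) = psi h + psi k ;
  bfZ : forall a h, bm h -> psi (fun t => a * h t) = a * psi h ;
  bf_le : forall h, bm h -> `|psi h| <= C * \int[mu]_t `|h t| }.

Lemma bf_sum psi C n (h : nat -> T -> R) : bounded_functional psi C ->
  (forall i, bm (h i)) ->
  psi (fun t => \sum_(i < n) h i t) = \sum_(i < n) psi (h i).
Proof.
move=> bf bh; elim: n => [|n IHn].
  rewrite big_ord0 (_ : (fun t => _) = fun t => 0 * cst 0 t).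
    by rewrite (bfZ bf) ?mul0r//; exact: bm_cst.
  by apply/funext => t; rewrite big_ord0 mul0r.
rewrite big_ord_recr/= -IHn -(bfD bf)//; last exact: bm_sum.
by congr psi; apply/funext => t; rewrite big_ord_recr.
Qed.

Lemma bf_simple psi psi' C C' h : bounded_functional psi C ->
  bounded_functional psi' C' ->
  (forall A, measurable A -> psi \1_A = psi' \1_A) -> simple_fun h ->
  psi h = psi' h.
Proof.
move=> bf bf' pp sh; have [p [g [sp ->]]] := simple_factor (V := R) sh.
have [n pn] := simple_bounded sp.
have bp (k : nat) : bm \1_(p @^-1` [set k]) by apply: bm_indic; exact: sp.2.
rewrite (_ : g \o p = (fun t => \sum_(i < n) g i * \1_(p @^-1` [set nat_of_ord i]) t)).
  have bgp (k : nat) : bm (fun t => g k * \1_(p @^-1` [set k]) t) by exact: bmZ.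
  rewrite (bf_sum n bf bgp) (bf_sum n bf' bgp); apply: eq_bigr => k _.
  by rewrite (bfZ bf)// (bfZ bf')// pp//; exact: sp.2.
apply/funext => t; rewrite (bigD1 (Ordinal (pn t)))//= big1 ?addr0.
  by rewrite indicE mem_set// mulr1.
move=> k kt; rewrite indicE memNset ?mulr0//= => ptk.
by move: kt; rewrite -val_eqE/= ptk eqxx.
Qed.

Lemma bm_approx h (e : R) : bm h -> 0 < e ->
  exists s, simple_fun s /\ \int[mu]_t `|h t - s t| < e.
Proof.
move=> bh e0.
have [s [_ _ sh]] := approximation_sfun_integrable measurableT (bm_integrable mu bh).
have ss n : simple_fun (s n).
  by split=> [|a]; [exact: fimfunP|exact: measurable_sfunP].
have : \forall n \near \oo, (\int[mu]_t `|(h t)%:E - (s n t)%:E| < e%:E)%E.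
  by apply: (sh [set y | (y < e%:E)%E]); apply: open_ereal_lt'; rewrite lte_fin.
move=> [n _ /(_ n (leqnn n)) /= hn]; exists (s n); split=> //.
rewrite -lte_fin fineK; first exact: hn.
apply: integrable_fin_num => //; apply: (bm_integrable mu).
apply: bm_norm; apply: (bmD bh); apply: bmN; exact: bm_simple.
Qed.

(** Both functionals are continuous for the L1 norm, in which simple functions approximate [h]. *)
Lemma bf_ext psi psi' C C' h : bounded_functional psi C ->
  bounded_functional psi' C' ->
  (forall A, measurable A -> psi \1_A = psi' \1_A) -> bm h ->
  psi h = psi' h.
Proof.
move=> bf bf' pp bh; apply/eqP; rewrite -subr_eq0 -normr_le0.
apply/ler_addgt0Pr => e e0; rewrite add0r.
(* [C] and [C'] carry no sign, hence the absolute values; the 1 keeps the divisor positive. *)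
have N0 : 0 < `|C| + `|C'| + 1 by rewrite ltr_wpDl.
have [s [ss hs]] := bm_approx bh (divr_gt0 e0 N0).
have bs := bm_simple ss; have bNs := bmN bs.
have bk := bmD bh bNs.
have hE : h = (h \+ (fun t => - s t)) \+ s.
  by apply/funext => t; rewrite /= subrK.
rewrite hE (bfD bf)// (bfD bf')// (bf_simple bf bf' pp ss) opprD.
rewrite addrACA subrr addr0.
apply: le_trans (ler_normB _ _) _.
rewrite (le_trans (lerD (bf_le bf bk) (bf_le bf' bk)))//.
have i0 : 0 <= \int[mu]_t `|(h \+ (fun t => - s t)) t| by apply: Rintegral_ge0.
apply: (@le_trans _ _ ((`|C| + `|C'| + 1) * \int[mu]_t `|(h \+ (fun t => - s t)) t|)).
  by rewrite -mulrDl ler_wpM2r//; rewrite -[leLHS]addr0 lerD// lerD// ler_norm.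
by rewrite mulrC -ler_pdivlMr// ltW.
Qed.

Lemma bf_integral g : bm g -> exists C, bounded_functional (fun h => I (h \* g)) C.
Proof.
move=> bg; have [_ [M gM]] := bg; exists M; split.
- move=> h k bh bk; rewrite -bm_integralD; [|exact: bmM..].
  by apply: eq_Rintegral => t _ /=; rewrite mulrDl.
- move=> a h bh; rewrite -bm_integralZ; last exact: bmM.
  by apply: eq_Rintegral => t _ /=; rewrite mulrA.
move=> h bh; rewrite -bm_integralZ; last exact: bm_norm.
have bhg := bmM bh bg.
rewrite (le_trans (le_normr_Rintegral _ (bm_integrable mu bhg)))//.
apply: le_Rintegral => //.
- by apply: bm_integrable; exact: bm_norm.
- by apply: bm_integrable; apply: bmZ; exact: bm_norm.
by move=> t _ /=; rewrite normrM mulrC ler_wpM2r.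
Qed.

Lemma integral_indic_mul f A : measurable A ->
  \int[mu]_(t in A) f t = I (\1_A \* f).
Proof.
move=> mA; rewrite Rintegral_mkcond; apply: eq_Rintegral => t _.
rewrite /= patchE indicE; case: ifPn => tA; first by rewrite mul1r.
by rewrite mul0r.
Qed.

Lemma bm_integral_indic A : measurable A -> I \1_A = fine (mu A).
Proof. by move=> mA; rewrite /Rintegral integral_indic// setIT. Qed.

(** Separates the excess above [c] from the excess below [- c]; the two are integrated separately
    when a density is truncated. *)
Lemma truncation_dist (c x : R) : 0 <= c ->
  `|x - Num.max (- c) (Num.min c x)| =
  (if c < x then x - c else 0) + (if x < - c then - c - x else 0).
Proof.
move=> c0; have [cx|xc] := ltP c x.
  have -> : (x < - c) = false by apply/negbTE; rewrite -leNgt; lra.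
  by rewrite addr0 max_r; [rewrite ger0_norm; lra|lra].
have [xNc|Ncx] := ltP x (- c); last by rewrite subrr normr0 addr0.
by rewrite add0r ler0_norm; lra.
Qed.

Section Density.
Variables (psi : (T -> R) -> R) (C : R).
Hypothesis bf : bounded_functional psi C.

Let nu A := (psi \1_A)%:E.

Let psi0 : psi (\1_set0) = 0.
Proof.
rewrite (_ : \1_set0 = fun t => 0 * (cst 0 t : R)).
  by rewrite (bfZ bf) ?mul0r//; exact: bm_cst.
by apply/funext => t; rewrite indic0 mul0r.
Qed.

Let psiU A B : measurable A -> measurable B -> A `&` B = set0 ->
  psi \1_(A `|` B) = psi \1_A + psi \1_B.
Proof.
move=> mA mB AB; rewrite -(bfD bf); [|exact: bm_indic..].
congr psi; apply/funext => t /=; rewrite !indicE.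
have [tA|tA] := pselect (A t); have [tB|tB] := pselect (B t).
- by have : set0 t by rewrite -AB.
- by rewrite (mem_set tA) (memNset tB) mem_set ?addr0//; left.
- by rewrite (memNset tA) (mem_set tB) mem_set ?add0r//; right.
- by rewrite (memNset tA) (memNset tB) memNset ?addr0//; case.
Qed.

Let psi_le A : measurable A -> `|psi \1_A| <= C * fine (mu A).
Proof.
move=> mA; rewrite (le_trans (bf_le bf (bm_indic R mA)))// -bm_integral_indic//.
by rewrite (@eq_Rintegral _ _ _ mu setT \1_A)// => t _; rewrite ger0_norm// indicE.
Qed.

Let psi_bigsetU (F : nat -> set T) n : (forall i, measurable (F i)) ->
  trivIset setT F ->
  psi \1_(\big[setU/set0]_(i < n) F i) = \sum_(i < n) psi \1_(F i).
Proof.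
move=> mF tF; elim: n => [|n IHn]; first by rewrite !big_ord0.
rewrite !big_ord_recr/= psiU ?IHn//; first exact: bigsetU_measurable.
apply/seteqP; split=> // t; rewrite -bigcup_mkord => -[[k /= kn Fkt] Fnt].
have kn' : k = n by apply: tF => //; exists t.
by rewrite kn' ltnn in kn.
Qed.

(** The tail left after n sets has [psi] bounded by a constant times its [mu]-measure, which tends
    to 0 by continuity of [mu] along increasing unions. *)
Let nu_sigma_additive : semi_sigma_additive nu.
Proof.
move=> F mF tF mUF.
pose B n := \big[setU/set0]_(i < n) F i.
have mB n : measurable (B n) by apply: bigsetU_measurable.
have BF n : B n `<=` \bigcup_k F k.
  by rewrite /B -bigcup_mkord => t [k _ Fkt]; exists k.
rewrite (_ : (fun n => _) = EFin \o (fun n => psi \1_(B n))); last first.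
  by apply/funext => n /=; rewrite /B psi_bigsetU// sumEFin big_mkord.
apply: cvg_EFin; first exact: nearW.
have muB : fine (mu (B n)) @[n --> \oo] --> fine (mu (\bigcup_k F k)).
  apply: fine_cvg; rewrite fineK ?fin_num_measure//.
  have BE : \bigcup_n B n = \bigcup_k F k.
    apply/seteqP; split=> t [k _ Bkt]; first exact: BF Bkt.
    by exists k.+1 => //; rewrite /B -bigcup_mkord; exists k => //=.
  rewrite -BE; apply: nondecreasing_cvg_mu => //; first by rewrite BE.
  by move=> n m nm; rewrite subsetEset; exact: subset_bigsetU.
apply/cvgrPdist_lt => e e0.
have N0 : 0 < `|C| + 1 by rewrite ltr_wpDl.
move/cvgrPdist_lt : muB => /(_ _ (divr_gt0 e0 N0)); apply: filterS => n /= muBn.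
set A := \bigcup_k F k in BF mUF muBn *.
have mD : measurable (A `\` B n) by apply: measurableD.
have BD : B n `&` (A `\` B n) = set0 by apply/seteqP; split=> // t [? []].
have psiE : psi \1_A = psi \1_(B n) + psi \1_(A `\` B n).
  by rewrite -psiU ?setDUK.
have muE : fine (mu A) = fine (mu (B n)) + fine (mu (A `\` B n)).
  by rewrite -fineD ?fin_num_measure// -measureU// setDUK.
move: muBn; rewrite muE addrAC subrr add0r ger0_norm ?fine_ge0//.
rewrite ltr_pdivlMr// psiE addrAC subrr add0r; apply: le_lt_trans.
rewrite (le_trans (psi_le mD))// mulrC ler_wpM2l ?fine_ge0//.
by rewrite (le_trans (ler_norm C))// lerDl.
Qed.

(** Radon-Nikodym gives an integrable density [f0] of the charge [nu]. Since [nu] is dominated by a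
    multiple of [mu], truncating [f0] at that level changes it only on a null set, and the
    truncation [g] is bounded. *)
Lemma functional_density : exists g, bm g /\ forall h, bm h -> psi h = I (h \* g).
Proof.
pose nuc := HB.pack_for (charge T R) nu
  (isCharge.Build _ T R nu (congr1 EFin psi0) (fun _ _ => erefl) nu_sigma_additive).
have numu : null_dominates mu nuc.
  move=> A A0 B mB BA; rewrite /= /nu; congr EFin; apply/eqP.
  rewrite -normr_le0 (le_trans (psi_le mB))//.
  by rewrite [mu B](_ : _ = 0%E) ?mulr0//; exact: A0.
have fE A := @Radon_Nikodym_integral _ _ _ nuc mu A numu.
have f_int := Radon_Nikodym_integrable numu.
have f_fin t := @Radon_Nikodym_fin_num _ _ _ nuc mu t numu.
set f := Radon_Nikodym _ _ in fE f_int f_fin.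
pose f0 := fine \o f.
have f0f : EFin \o f0 = f by apply/funext => t /=; rewrite fineK.
have if0 : int f0 by rewrite f0f.
have mf0 : measurable_fun setT f0.
  by apply/measurable_EFinP; rewrite f0f; exact: measurable_int f_int.
have psiE A : measurable A -> psi \1_A = I (\1_A \* f0).
  move=> mA; rewrite -integral_indic_mul//.
  have := fE A mA; rewrite -[LHS]/((psi \1_A)%:E) -f0f => E.
  by rewrite /Rintegral -[RHS]/(fine (\int[mu]_(t in A) (EFin \o f0) t)%E) -E.
pose c := `|C|.
pose g t := Num.max (- c) (Num.min c (f0 t)).
have gc t : `|g t| <= c.
  have c0 : 0 <= c by exact: normr_ge0.
  by rewrite ler_norml /g le_max lexx/= ge_max ge_min lexx/= andbT (le_trans _ c0)// oppr_le0.
have bg : bm g.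
  split; last by exists c.
  by apply: measurable_maxr => //; exact: measurable_minr.
have ig := bm_integrable mu bg.
pose A := [set t | c < f0 t]; pose B := [set t | f0 t < - c].
have mA : measurable A.
  rewrite (_ : A = setT `&` f0 @^-1` `]c, +oo[); last first.
    by rewrite setTI; apply/seteqP; split=> t /=; rewrite in_itv/= andbT.
  by apply: mf0 => //; exact: measurable_itv.
have mB : measurable B.
  rewrite (_ : B = setT `&` f0 @^-1` `]-oo, - c[); last first.
    by rewrite setTI; apply/seteqP; split=> t /=; rewrite in_itv.
  by apply: mf0 => //; exact: measurable_itv.
pose u := (fun t => f0 t - c) \_ A.
pose v := (fun t => - c - f0 t) \_ B.
have ic D : measurable D -> mu.-integrable D (EFin \o (cst c : T -> R)).
  move=> mD; apply: (integrableS measurableT) => //.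
  by apply: bm_integrable; exact: bm_cst.
have if0D D : measurable D -> mu.-integrable D (EFin \o f0).
  by move=> mD; exact: (integrableS measurableT).
have psiD D : measurable D -> \int[mu]_(t in D) f0 t = psi \1_D.
  by move=> mD; rewrite psiE// integral_indic_mul.
have psic D : measurable D -> `|psi \1_D| <= c * fine (mu D).
  by move=> mD; rewrite (le_trans (psi_le mD))// ler_wpM2r ?fine_ge0// ler_norm.
(* The integral of [f0] over [A] is [psi] of its indicator, hence at most [c] times the measure of
   [A], although [f0] exceeds [c] there. *)
have Iu : I u <= 0.
  rewrite -Rintegral_mkcond RintegralB//; [|exact: if0D|exact: ic].
  rewrite Rintegral_cst// subr_le0 psiD//.
  by rewrite (le_trans (ler_norm _))// psic.
have Iv : I v <= 0.
  rewrite -Rintegral_mkcond.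
  rewrite (@eq_Rintegral _ _ _ mu B (fun t => -1 * (c + f0 t))); last first.
    by move=> t _; rewrite mulN1r opprD.
  rewrite RintegralZl//; last first.
    rewrite (_ : EFin \o _ = (EFin \o cst c) \+ (EFin \o f0))%E//.
    by apply: integrableD => //; [exact: ic|exact: if0D].
  rewrite RintegralD//; [|exact: ic|exact: if0D].
  rewrite Rintegral_cst// mulN1r oppr_le0 psiD//.
  by have := psic B mB; rewrite ler_norml => /andP[+ _]; rewrite -subr_ge0 opprK addrC.
have iu : int u.
  rewrite /u -restrict_EFin; apply: (integrable_mkcond _ mA).1.
  rewrite (_ : EFin \o _ = (EFin \o f0) \- (EFin \o cst c))%E//.
  exact: (integrableB mA (if0D A mA) (ic A mA)).
have iv : int v.
  rewrite /v -restrict_EFin; apply: (integrable_mkcond _ mB).1.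
  rewrite (_ : EFin \o _ = (EFin \o (cst (- c)%R : T -> R)) \- (EFin \o f0))%E//.
  apply: integrableB => //; [|exact: if0D].
  apply: (integrableS measurableT) => //.
  by apply: bm_integrable; exact: bm_cst.
have c0 : 0 <= c by exact: normr_ge0.
have uv t : `|f0 t - g t| = u t + v t.
  rewrite /u /v !patchE /g truncation_dist//; congr (_ + _).
    by rewrite /A; case: ifPn => tA; [rewrite mem_set|rewrite memNset//; exact/negP].
  by rewrite /B; case: ifPn => tB; [rewrite mem_set|rewrite memNset//; exact/negP].
(* The truncation error is [u + v], and neither integral is positive. *)
have I0 : \int[mu]_t `|f0 t - g t| <= 0.
  rewrite (@eq_Rintegral _ _ _ mu setT (fun t => u t + v t)) ?RintegralD//.
  by rewrite -[leRHS]addr0 lerD.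
exists g; split=> // h bh; have [C' bfg] := bf_integral bg.
apply: (bf_ext bf bfg) => // D mD.
apply/eqP; rewrite -subr_eq0 -normr_le0 psiE// -!integral_indic_mul//.
rewrite -RintegralB//; [|exact: if0D|exact: (integrableS measurableT)].
have iD : mu.-integrable setT (EFin \o (fun t => f0 t - g t)).
  rewrite (_ : EFin \o _ = (EFin \o f0) \- (EFin \o g))%E//.
  exact: integrableB.
rewrite (le_trans (le_normr_Rintegral _ (integrableS measurableT mD _ iD)))//.
apply: le_trans I0; rewrite Rintegral_mkcond; apply: le_Rintegral => //.
- rewrite -restrict_EFin; apply: (integrable_mkcond _ mD).1.
  apply: (integrableS measurableT) => //.
  exact: (integrable_norm iD).
- exact: integrable_norm iD.
- by move=> t _; rewrite patchE; case: ifP => // _; exact: normr_ge0.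
Qed.

End Density.
End ScalarFunctionals.

(** * Orthonormal systems of bounded functions *)

Section OrthonormalSystem.
Context d (T : measurableType d) (R : realType).
Context (mu : {finite_measure set T -> \bar R}).
Local Notation bm := (@bounded_measurable _ T R).
Implicit Types (f g h k : T -> R).

Definition inner h k : R := \int[mu]_t (h t * k t).

Lemma innerC h k : inner h k = inner k h.
Proof. by apply: eq_Rintegral => t _; rewrite mulrC. Qed.

Lemma innerDl h k g : bm h -> bm k -> bm g ->
  inner (h \+ k) g = inner h g + inner k g.
Proof.
move=> bh bk bg; rewrite /inner -bm_integralD; [|exact: bmM..].
by apply: eq_Rintegral => t _ /=; rewrite mulrDl.
Qed.

Lemma innerZl a h g : bm h -> bm g -> inner (fun t => a * h t) g = a * inner h g.
Proof.
move=> bh bg; rewrite /inner -bm_integralZ; last exact: bmM.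
by apply: eq_Rintegral => t _ /=; rewrite mulrA.
Qed.

Lemma inner_ge0 h : 0 <= inner h h.
Proof. by apply: Rintegral_ge0 => t _; rewrite -expr2 sqr_ge0. Qed.

Lemma innerDZ a h k g : bm h -> bm k -> bm g ->
  inner (h \+ (fun t => a * k t)) g = inner h g + a * inner k g.
Proof. by move=> bh bk bg; rewrite innerDl ?innerZl//; exact: bmZ. Qed.

(** Cauchy-Schwarz for a form that is only semidefinite: with s = b/(a+1), the inner square of g - s
    h is -s^2 (a+2), which forces s = 0 and b = 0. The 1 avoids a division by a = 0. *)
Lemma inner_eq0 h g : bm h -> bm g -> inner g g = 0 -> inner h g = 0.
Proof.
move=> bh bg g0; apply/eqP; rewrite -sqrf_eq0 eq_le sqr_ge0 andbT.
set b := inner h g; set a := inner h h.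
have a0 : 0 <= a by exact: inner_ge0.
pose s := b / (a + 1).
have bhs : bm (g \+ (fun t => - s * h t)) by apply: bmD => //; exact: bmZ.
have IG k : bm k -> inner (g \+ (fun t => - s * h t)) k = inner g k + - s * inner h k.
  by move=> bk; rewrite innerDZ.
have := inner_ge0 (g \+ (fun t => - s * h t)).
rewrite IG// (innerC g) (innerC h) !IG// g0 add0r (innerC g h) -/a -/b.
have a1 : a + 1 != 0 by rewrite gt_eqF// ltr_wpDl.
have sE : s * (a + 1) = b by rewrite divfK.
rewrite -sE => H; have {H} : s ^+ 2 * (a + 2) <= 0.
  rewrite -oppr_ge0; apply: le_trans H _; rewrite le_eqVlt; apply/orP; left.
  by apply/eqP; ring.
rewrite pmulr_lle0; last by rewrite ltr_wpDl.
by move=> s0; rewrite exprMn; exact: mulr_le0_ge0 s0 (sqr_ge0 _).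
Qed.

Definition orthonormal (E : set (T -> R)) : Prop :=
  (forall e, E e -> bm e /\ inner e e = 1) /\
  (forall e e', E e -> E e' -> e <> e' -> inner e e' = 0).

(** Zorn's lemma: a bounded [g] orthogonal to [E] with [inner g g > 0] could be normalised and
    added. The conclusion is not [g = 0], since functions are not identified almost everywhere. *)
Lemma maximal_orthonormal : exists E, orthonormal E /\
  forall g, bm g -> (forall e, E e -> inner e g = 0) -> inner g g = 0.
Proof.
have [F FP totF|E [oE maxE]] := @Zorn_bigcup (T -> R) orthonormal.
  split=> [e [A FA Ae]|e e' [A FA Ae] [B FB Be']]; first exact: (FP A FA).1.
  have [AB|BA] := totF _ _ FA FB.
    by apply: (FP B FB).2 => //; exact: AB.
  by apply: (FP A FA).2 => //; exact: BA.
exists E; split=> // g bg Eg; apply/eqP; apply: contrapT => /negP g0.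
have gp : 0 < inner g g by rewrite lt0r inner_ge0 andbT.
pose c := (Num.sqrt (inner g g))^-1; pose e0 t := c * g t.
have be0 : bm e0 by exact: bmZ.
have Ee0 e : E e -> inner e e0 = 0.
  move=> Ee; have be := (oE.1 _ Ee).1.
  by rewrite innerC innerZl// (innerC g) Eg// mulr0.
have e01 : inner e0 e0 = 1.
  rewrite innerZl// (innerC g) innerZl// mulrA -expr2 exprVn sqr_sqrtr ?ltW//.
  by rewrite mulVf// gt_eqF.
have nEe0 : ~ E e0 by move=> /Ee0; rewrite e01 => /eqP; rewrite oner_eq0.
apply: (maxE (E `|` [set e0])).
  split; first by move=> e Ee; left.
  by move=> /(_ e0 (or_intror erefl)).
split=> [e [/oE.1//|->//]|e e' [Ee|->] [Ee'|->]].
- exact: oE.2.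
- by move=> _; exact: Ee0.
- by move=> _; rewrite innerC; exact: Ee0.
- by [].
Qed.

Lemma bessel (e : nat -> T -> R) g n : (forall i, bm (e i)) -> bm g ->
  (forall i j, inner (e i) (e j) = (i == j)%:R) ->
  \sum_(i < n) inner (e i) g ^+ 2 <= inner g g.
Proof.
move=> be bg oe.
(* [r m] is [g] minus its projections on the first m vectors. *)
pose r := fix r n := if n is m.+1 then
  r m \+ (fun t => - inner (e m) g * e m t) else g.
have br m : bm (r m) by elim: m => //= m IHm; apply: bmD => //; exact: bmZ.
have re m j : (m <= j)%N -> inner (r m) (e j) = inner (e j) g.
  elim: m => [|m IHm] mj /=; first exact: innerC.
  by rewrite innerDZ// IHm ?(ltnW mj)// oe ltn_eqF// mulr0 addr0.
suff <- : inner (r n) (r n) + \sum_(i < n) inner (e i) g ^+ 2 = inner g g.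
  by rewrite lerDr inner_ge0.
elim: n => [|n IHn]; first by rewrite big_ord0 addr0.
rewrite big_ord_recr/= -IHn; set q := _ \+ _.
have bq : bm q by apply: bmD => //; exact: bmZ.
have IG k : bm k -> inner q k = inner (r n) k + - inner (e n) g * inner (e n) k.
  by move=> bk; rewrite innerDZ.
rewrite IG// (innerC (r n) q) (innerC (e n) q) !IG//.
rewrite (innerC (e n) (r n)) re// oe eqxx -[true%:R]/(1 : R); ring.
Qed.

(** For each n only finitely many vectors have squared coefficient above 1/(n+1): infinitely many
    would give m/(n+1) <= [inner g g] for every m by Bessel's inequality. *)
Lemma orthonormal_countable E g : orthonormal E -> bm g ->
  countable [set e | E e /\ inner e g != 0].
Proof.
move=> oE bg.
have -> : [set e | E e /\ inner e g != 0] =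
    \bigcup_(n in [set: nat]) [set e | E e /\ n.+1%:R^-1 < inner e g ^+ 2].
  apply/seteqP; split=> [e [Ee ne]|e [n _ [Ee ne]]]; last first.
    split=> //; apply: contraTneq ne => ->.
    by rewrite expr0n/= -leNgt invr_ge0.
  have p : 0 < inner e g ^+ 2 by rewrite exprn_even_gt0.
  have [n _ /(_ n (leqnn n)) nP] := near_infty_natSinv_lt (PosNum p).
  by exists n.
apply: bigcup_countable => // n _; apply: finite_set_countable.
apply: contrapT => /infiniteP/pcard_leP[f].
have fE i : E (f i) /\ n.+1%:R^-1 < inner (f i) g ^+ 2.
  by have /(_ i I) := @funS _ _ _ _ f.
have finj i j : f i = f j -> i = j.
  by move=> ij; have := @inj _ _ _ f i j; apply; rewrite ?inE.
have be i : bm (f i) by have [] := oE.1 _ (fE i).1.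
have oe i j : inner (f i) (f j) = (i == j)%:R.
  have [->|ij] := eqVneq i j; first by have [] := oE.1 _ (fE j).1.
  apply: oE.2; [exact: (fE i).1|exact: (fE j).1|move/finj/eqP].
  by rewrite (negbTE ij).
have B m : m%:R * n.+1%:R^-1 <= inner g g.
  apply: le_trans (bessel m be bg oe).
  rewrite -[X in X%:R](card_ord m) -sum1_card natr_sum mulr_suml.
  by apply: ler_sum => i _; rewrite mul1r ltW//; exact: (fE i).2.
have := B (Num.truncn (inner g g * n.+1%:R)).+1.
rewrite ler_pdivrMr// leNgt => /negP; apply; exact: truncnS_gt.
Qed.

(** A bounded density [g] turns [psi e] into the coefficient of [g] along [e]; Bessel then gives
    countability and maximality gives totality. The uniform bound [C0] serves to make the witness
    for L1(mu, Y) a bounded operator. *)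
Lemma total_system : exists (E : set (T -> R)) (C0 : R),
  [/\ forall e, E e -> bm e /\ \int[mu]_t `|e t| <= C0,
      forall psi C, bounded_functional mu psi C ->
        countable [set e | E e /\ psi e != 0] &
      forall psi C, bounded_functional mu psi C ->
        (forall e, E e -> psi e = 0) -> forall h, bm h -> psi h = 0].
Proof.
have [E [oE maxE]] := maximal_orthonormal.
(* The constant integrates |x| <= 1 + x^2, using [inner e e = 1]. *)
exists E, (fine (mu setT) + 1); split.
- move=> e Ee; have [be e1] := oE.1 _ Ee; split=> //.
  have b1 : bm (cst 1) := bm_cst T (1 : R).
  have be2 := bmM be be.
  rewrite -[X in _ + X]e1 -[fine _]mul1r -Rintegral_cst//.
  rewrite -[X in _ <= X](bm_integralD mu b1 be2); apply: le_Rintegral => //.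
  + by apply: bm_integrable; exact: bm_norm.
  + by apply: bm_integrable; exact: bmD.
  move=> t _ /=; rewrite -expr2 -real_normK ?num_real//.
  set x := `|e t|; have := sqr_ge0 (x - 1); have := sqr_ge0 x.
  rewrite sqrrB1; lra.
- move=> psi C bf; have [g [bg psiE]] := functional_density bf.
  apply: (sub_countable _ (orthonormal_countable oE bg)).
  apply: subset_card_le => e [Ee]; rewrite psiE//.
  by have [] := oE.1 _ Ee.
move=> psi C bf psi0 h bh; have [g [bg psiE]] := functional_density bf.
rewrite psiE//; apply: (inner_eq0 bh bg); apply: maxE => // e Ee.
rewrite /inner -[LHS]/(\int[mu]_t (e \* g) t) -psiE ?psi0//.
by have [] := oE.1 _ Ee.
Qed.

End OrthonormalSystem.

(** * Functionals induced by weak* measurable fields *)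

Section FieldFunctional.
Context d (T : measurableType d) (R : realType).
Context (mu : {finite_measure set T -> \bar R}) (Y : completeNormedModType R).
Local Notation X := (L1 mu Y).
Local Notation bm := (@bounded_measurable _ T R).
Local Open Scope quotient_scope.

(** Convergence holds at every point, unlike in [strongly_measurable]: as [mu] may fail to be
    complete, this is what makes [s t (f t)] measurable in [t]. *)
Definition simple_limit (f : T -> Y) : Prop := exists s : nat -> T -> Y,
  (forall n, simple_fun (s n)) /\ forall t, s n t @[n --> \oo] --> f t.

Lemma simple_limit_repr : exists r : X -> T -> Y, forall q : X,
  simple_limit (r q) /\ {ae mu, forall t, (repr q : bochner mu Y) t = r q t}.
Proof.
suff H (q : X) : exists g, simple_limit g /\
    {ae mu, forall t, (repr q : bochner mu Y) t = g t}.
  by have [r rP] := choice H; exists r.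
have [g [s [ss sg qg]]] := strongly_measurableP (bochner_measurable (repr q)).
by exists g; split=> //; exists s.
Qed.

Variable s : T -> dual Y.
Hypothesis (ms : forall y, measurable_fun setT (fun t => s t y : R)).
Hypothesis (s1 : forall t, `|s t| <= 1).

Lemma field_measurable (f : T -> Y) : simple_limit f ->
  measurable_fun setT (fun t => s t (f t) : R).
Proof.
move=> [u [su uf]].
apply: (@measurable_fun_cvg _ _ _ _ (fun n t => s t (u n t) : R)).
  move=> n; have [p [g [sp ->]]] := simple_factor (V := Y) (su n).
  have [m pm] := simple_bounded sp.
  rewrite (_ : (fun t => _) = (fun t => \sum_(k < m)
    (\1_(p @^-1` [set nat_of_ord k]) t * s t (g k)) : R)).
    apply: measurable_sum => k; apply: measurable_funM => //.
    by apply: measurable_indic; exact: sp.2.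
  apply/funext => t; rewrite (bigD1 (Ordinal (pm t)))//= big1 ?addr0.
    by rewrite indicE mem_set// mul1r.
  move=> k kt; rewrite indicE memNset ?mul0r//= => ptk.
  by move: kt; rewrite -val_eqE/= ptk eqxx.
move=> t _; have c := @dual_continuous _ _ (s t) (f t).
exact: (@cvg_comp _ _ _ (u ^~ t) (s t : Y -> R^o) _ _ _ (uf t) c).
Qed.

Lemma field_le t y : `|s t y| <= `|y|.
Proof. by rewrite (le_trans (dual_apply_le _ _))// ler_piMl. Qed.

Lemma field_integrable (f : T -> Y) : simple_limit f -> (int_norm mu f < +oo)%E ->
  mu.-integrable setT (EFin \o (fun t => s t (f t) : R)) /\
  `|\int[mu]_t (s t (f t) : R)| <= fine (int_norm mu f).
Proof.
move=> lf ff; have mf := field_measurable lf.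
have mn : measurable_fun setT (fun t => (`|f t|)%:E).
  by have [u [su uf]] := lf; exact: limit_measurable su uf.
have le : (\int[mu]_t `|(EFin \o (fun t => s t (f t) : R)) t| <= int_norm mu f)%E.
  apply: ge0_le_integral => //.
    by apply: measurableT_comp => //; exact/measurable_EFinP.
  by move=> t _; rewrite /= lee_fin; exact: field_le.
have ig : mu.-integrable setT (EFin \o (fun t => s t (f t) : R)).
  apply/integrableP; split; first exact/measurable_EFinP.
  exact: le_lt_trans le ff.
split=> //; rewrite (le_trans (le_normr_Rintegral _ ig))//.
apply: fine_le => //.
  by rewrite ge0_fin_numE ?integral_ge0//; exact: le_lt_trans le ff.
by rewrite ge0_fin_numE// int_norm_ge0.
Qed.

Lemma ae_Rintegral (f g : T -> R) : measurable_fun setT f ->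
  measurable_fun setT g -> {ae mu, forall t, f t = g t} ->
  \int[mu]_t f t = \int[mu]_t g t.
Proof.
move=> mf mg fg; congr fine; apply: ae_eq_integral => //.
- exact/measurable_EFinP.
- exact/measurable_EFinP.
- by apply: filterS fg => t -> _.
Qed.

Lemma simple_limitP a (f g : T -> Y) : simple_limit f -> simple_limit g ->
  simple_limit (fun t => a *: f t + g t).
Proof.
move=> [u [su uf]] [v [sv vg]]; exists (fun n t => a *: u n t + v n t); split.
  by move=> n; exact: (simple_comp2 (fun x y => a *: x + y) (su n) (sv n)).
by move=> t; apply: cvgD => //; exact: cvgZl_tmp.
Qed.

(** The functional integrates [s t (q t)] over [t], computed on the representative [r q]; it is
    linear because the representatives combine linearly almost everywhere. *)
Lemma field_functional : exists Psi : dual X, `|Psi| <= 1 /\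
  forall h y, bm h -> Psi (tensor mu h y) = \int[mu]_t (h t * s t y).
Proof.
have [r rP] := simple_limit_repr.
have rfin q : (int_norm mu (r q) < +oo)%E.
  by rewrite -(ae_int_norm (rP q).2) ltey_eq bochner_fin.
pose P (q : X) : R^o := \int[mu]_t (s t (r q t) : R).
have P1 q : `|P q| <= `|q|.
  apply: (le_trans (field_integrable (rP q).1 (rfin q)).2).
  by rewrite -(ae_int_norm (rP q).2).
have mr q := field_measurable (rP q).1.
have ir q := (field_integrable (rP q).1 (rfin q)).1.
have lP : linear P.
  move=> a p q; rewrite -[RHS]/(a * P p + P q) /P.
  rewrite -RintegralZl// -RintegralD//; last first.
    exact: (integrableZl measurableT a (ir p)).
  rewrite (@ae_Rintegral _ (fun t => s t (a *: r p t + r q t) : R)) //.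
  - by apply: eq_Rintegral => t _; rewrite linearP.
  - by apply: field_measurable; apply: simple_limitP; [exact: (rP p).1|exact: (rP q).1].
  have E : a *: p + q = \pi_X (a *: repr p + repr q).
    by rewrite L1_piD [_ *: p]/(L1_scale a p) reprK.
  have := L1_reprP (a *: repr p + repr q); rewrite -E => H.
  apply: filterS3 H (filterI (rP p).2 (rP q).2) (rP (a *: p + q)).2.
  move=> t H [Hp Hq] Hpq; rewrite -Hpq H -Hp -Hq.
  by [].
have cP : continuous P.
  by apply: (linear_le_continuous (M := 1) lP) => q; rewrite mul1r.
have PP : P \in @dual_pred R X by rewrite inE.
exists (Dual PP); split; first exact: dual_norm_le1.
move=> h y bh; rewrite -[LHS]/(\int[mu]_t (s t (r (tensor mu h y) t) : R)).
have tb := tensor_bochner mu y bh.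
have [F FE FE'] := classE tb.
apply: ae_Rintegral => //; first by apply: measurable_funM => //; exact: bh.1.
have H := L1_reprP F; rewrite -FE' in H.
apply: filterS2 H (rP (tensor mu h y)).2 => t Ht <-.
have Ht' : (repr (tensor mu h y) : bochner mu Y) t = F t := Ht.
by rewrite Ht' -FE linearZ.
Qed.

End FieldFunctional.

(** * Averages over finite partitions *)

Lemma dual_scale_apply (R : realType) (V : normedModType R) (a : R) (f : dual V) x :
  (a *: f) x = a * f x.
Proof. by []. Qed.

Section Partitions.
Context d (T : measurableType d) (R : realType).
Context (mu : {finite_measure set T -> \bar R}) (Y : completeNormedModType R).
Local Notation X := (L1 mu Y).
Local Notation bm := (@bounded_measurable _ T R).

Definition refines (q p : T -> nat) : Prop := exists r : nat -> nat, p = r \o q.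

Definition partition_filter : set_system (T -> nat) :=
  filter_from [set p | simple_fun p] (fun p => [set q | simple_fun q /\ refines q p]).

Lemma partition_filter_proper : ProperFilter partition_filter.
Proof.
apply: filter_from_proper; last first.
  by move=> p sp; exists p; split=> //; exists id.
apply: filter_from_filter; first by exists (fun=> 0%N); exact: simple_cst.
(* Pairing the labels, coded in [nat], gives a common refinement. *)
move=> p q sp sq; pose pq t := pickle (p t, q t).
exists pq; first exact: (simple_comp2 (fun a b => pickle (a, b)) sp sq).
move=> u [su [r rE]]; split; split=> //.
  exists (fun n => if (unpickle (r n) : option (nat * nat)) is Some (a, _) then a else 0%N).
  by apply/funext => t /=; have := congr1 (@^~ t) rE; rewrite /pq /= => <-; rewrite pickleK.
exists (fun n => if (unpickle (r n) : option (nat * nat)) is Some (_, b) then b else 0%N).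
by apply/funext => t /=; have := congr1 (@^~ t) rE; rewrite /pq /= => <-; rewrite pickleK.
Qed.

Variable phi : dual X.
Hypothesis phi1 : `|phi| <= 1.

(* On a null block 0^-1 = 0 makes the average 0, which is right because pull
   vanishes there. *)
Definition block_average (p : T -> nat) (k : nat) : dual Y :=
  (fine (mu (p @^-1` [set k])))^-1 *: pull phi \1_(p @^-1` [set k]).

Lemma norm_pull_indic A : measurable A -> `|pull phi \1_A| <= fine (mu A).
Proof.
move=> mA; have bA := bm_indic R mA.
rewrite (le_trans (norm_pull_le _ bA))// -(bm_integral_indic mu mA).
rewrite (@eq_Rintegral _ _ _ mu setT \1_A).
  by rewrite ler_piMl//; apply: Rintegral_ge0 => t _; rewrite indicE.
by move=> t _; rewrite ger0_norm// indicE.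
Qed.

Lemma block_average_le1 p k : simple_fun p -> `|block_average p k| <= 1.
Proof.
move=> sp; rewrite /block_average normrZ; set m := fine _.
have m0 : 0 <= m by rewrite fine_ge0.
rewrite ger0_norm ?invr_ge0//; have [->|mn0] := eqVneq m 0.
  by rewrite invr0 mul0r.
by rewrite mulrC ler_pdivrMr ?lt0r ?mn0// mul1r norm_pull_indic//; exact: sp.2.
Qed.

Lemma block_averageK p k : simple_fun p ->
  fine (mu (p @^-1` [set k])) *: block_average p k = pull phi \1_(p @^-1` [set k]).
Proof.
move=> sp; rewrite /block_average scalerA; set m := fine _.
have [m0|m0] := eqVneq m 0; last by rewrite divff// scale1r.
apply/esym/eqP; rewrite m0 mul0r scale0r -normr_le0 -m0.
by apply: norm_pull_indic; exact: sp.2.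
Qed.

Lemma block_average_measurable p y : simple_fun p ->
  measurable_fun setT (fun t => block_average p (p t) y : R).
Proof.
move=> sp; apply: simple_measurable.
exact: (simple_comp (fun k => block_average p k y : R) sp).
Qed.

(** [b p] is induced by the averaged field: on tensors it amounts to applying [phi] after replacing
    [h] by its conditional expectation on the blocks of [p]. *)
Lemma partition_functional : exists b : (T -> nat) -> dual_ball X,
  forall p, simple_fun p -> forall h y, bm h ->
  dual_of (b p) (tensor mu h y) = \int[mu]_t (h t * block_average p (p t) y).
Proof.
suff H p : exists b : dual_ball X, simple_fun p -> forall h y, bm h ->
    dual_of b (tensor mu h y) = \int[mu]_t (h t * block_average p (p t) y).
  by have [b bP] := choice H; exists b.
have [sp|nsp] := pselect (simple_fun p); last by exists point.
have [Psi [Psi1 PsiE]] := @field_functional _ _ _ mu Y (fun t => block_average p (p t))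
  (fun y => block_average_measurable y sp) (fun t => block_average_le1 (p t) sp).
by have [b bE] := dual_ballE Psi1; exists b => _ h y bh; rewrite bE PsiE.
Qed.

Variable b : (T -> nat) -> dual_ball X.
Hypothesis bP : forall p, simple_fun p -> forall h y, bm h ->
  dual_of (b p) (tensor mu h y) = \int[mu]_t (h t * block_average p (p t) y).

(** Only finitely many block averages enter, whatever [h] is, so all pulls of [b p] vanish at any
    coordinate where these averages do. *)
Lemma partition_functional_pull p h n : simple_fun p -> bm h ->
  (forall t, (p t < n)%N) -> pull (dual_of (b p)) h =
  \sum_(k < n) (\int[mu]_t (h t * \1_(p @^-1` [set nat_of_ord k]) t)) *:
    block_average p k.
Proof.
move=> sp bh pn; apply: dual_ext => y; rewrite pullE// bP//.
have bp (k : nat) : bm \1_(p @^-1` [set k]) by apply: bm_indic; exact: sp.2.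
rewrite (@eq_Rintegral _ _ _ mu setT (fun t => \sum_(k < n)
    block_average p k y * (h t * \1_(p @^-1` [set nat_of_ord k]) t))); last first.
  move=> t _; rewrite (bigD1 (Ordinal (pn t)))//= big1 ?addr0.
    by rewrite indicE mem_set// mulr1 mulrC.
  move=> k kt; rewrite indicE memNset ?mulr0//= => ptk.
  by move: kt; rewrite -val_eqE/= ptk eqxx.
have bhp (k : nat) : bm (fun t => h t * \1_(p @^-1` [set k]) t) by exact: bmM.
rewrite (bm_integral_sum mu n (fun k => bmZ (block_average p k y) (bhp k))).
have sumE m (f : 'I_m -> dual Y) : (\sum_(k < m) f k) y = \sum_(k < m) f k y.
  by elim/big_ind2 : _ => // u v u' v' <- <-.
rewrite sumE; apply: eq_bigr => k _; rewrite bm_integralZ// mulrC.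
by rewrite dual_scale_apply.
Qed.

Lemma partition_functional_block p k : simple_fun p ->
  pull (dual_of (b p)) \1_(p @^-1` [set k]) = pull phi \1_(p @^-1` [set k]).
Proof.
move=> sp; have bk : bm \1_(p @^-1` [set k]) by apply: bm_indic; exact: sp.2.
apply: dual_ext => y; rewrite [LHS]pullE// bP//.
rewrite -(block_averageK k sp) dual_scale_apply.
rewrite (@eq_Rintegral _ _ _ mu setT (fun t =>
    block_average p k y * \1_(p @^-1` [set k]) t)); last first.
  move=> t _; rewrite indicE; have [<-|tk] := eqVneq (p t) k.
    by rewrite mulrC.
  by rewrite memNset ?mul0r ?mulr0//= => ptk; rewrite ptk eqxx in tk.
by rewrite bm_integralZ// mulrC bm_integral_indic//; exact: sp.2.
Qed.

(** If [p'] refines [p], then [b p'] and [phi] agree on fields constant on the blocks of [p]. Such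
    fields, over all [p], are dense, and the functionals involved have norm at most 1. *)
Lemma partition_approximation (bphi : dual_ball X) : dual_of bphi = phi ->
  b @ partition_filter --> bphi.
Proof.
move=> bphiE; have PF := partition_filter_proper.
apply: dual_ball_cvg => q; rewrite bphiE; apply/cvgrPdist_lt => e e0.
have e2 : 0 < e / 2 by rewrite divr_gt0.
have [p [g [sp pq]]] := simple_class_dense q e2.
exists p => // p' [sp' [r rE]] /=.
set c := integrable_class mu (g \o p) in pq.
have E : phi c = dual_of (b p') c.
  have cE : c = integrable_class mu ((g \o r) \o p') by rewrite /c rE.
  rewrite cE; apply: pull_simple_class => // k.
  by rewrite partition_functional_block.
have H1 : phi (c - q) = phi c - phi q := linearB phi c q.
have H2 : dual_of (b p') (c - q) = dual_of (b p') c - dual_of (b p') q :=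
  linearB (dual_of (b p')) c q.
rewrite (_ : phi q - _ = dual_of (b p') (c - q) - phi (c - q)); last first.
  by rewrite H1 H2 E opprB [RHS]addrC addrA subrK.
rewrite (le_lt_trans (ler_normB _ _))// [ltRHS]splitr ltrD//.
  exact: le_lt_trans (dual_of_le _ _) pq.
by rewrite (le_lt_trans _ pq)// (le_trans (dual_apply_le _ _))// ler_piMl.
Qed.

End Partitions.

(** * Supports and coordinates *)

Section Support.
Context (R : realType) (K : ptopologicalType) (P : probability (borel K) R).

(** Regularity gives a compact [C] of positive measure inside [U]. If [U] missed the support, each
    point of [C] would have a null open neighbourhood, and compactness would make [C] null. *)
Lemma measure_support_meets (U : set K) : regular_measure P -> open U ->
  (0 < P U)%E -> exists2 x, measure_support P x & U x.
Proof.
move=> rP oU PU; apply: contrapT => nx.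
have mopen (V : set K) : open V -> measurable (V : set (borel K)).
  by move=> oV; exact: sub_sigma_algebra.
have null x : U x -> exists V, [/\ open V, V x & P V = 0%E].
  move=> Ux; apply: contrapT => nV; apply: nx; exists x => // V oV Vx.
  rewrite lt0e measure_ge0 andbT; apply/eqP => PV0.
  by apply: nV; exists V.
move: PU; rewrite (rP U (mopen _ oU)).2 => /ereal_sup_gt[_ [C [cC clC CU] <-]] PC.
have mC : measurable (C : set (borel K)).
  by rewrite -[C]setCK; apply: measurableC; apply: mopen; exact: closed_openC.
(* The covering argument in filter form: [F] consists of the sets containing [C] up to a null set,
   and no cluster point of it has a null open neighbourhood. *)
pose F : set_system K := [set B | exists N : set (borel K),
  [/\ measurable N, P N = 0%E & C `\` N `<=` B]].
have FF : ProperFilter F.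
  apply: Build_ProperFilter_ex; last first.
    split.
    - by exists set0; split=> //; exact: measure0.
    - move=> A B [M [mM M0 MA]] [N [mN N0 NB]]; exists (M `|` N); split.
      + exact: measurableU.
      + have : (P (M `|` N) <= P M + P N)%E := measureU2 P mM mN.
        rewrite M0 N0 adde0 => PMN.
        by apply/eqP; rewrite eq_le measure_ge0 andbT.
      + move=> x [Cx /not_orP[Mx Nx]]; split; [exact: MA|exact: NB].
    - by move=> A B AB [M [mM M0 MA]]; exists M; split=> // x /MA/AB.
  move=> B [N [mN N0 NB]]; apply: contrapT => nB; move: PC; apply/negP.
  rewrite -leNgt -N0; apply: le_measure; rewrite ?inE// => x Cx.
  by apply: contrapT => Nx; apply: nB; exists x; exact: NB.
have [|x [Cx Fx]] := cC F FF.
  by exists set0; split=> // x [].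
have [V [oV Vx PV0]] := null _ (CU _ Cx).
have FV : F (~` V) by exists V; split; [exact: mopen| |move=> y []].
by have [y []] := Fx _ _ FV (open_nbhs_nbhs (conj oV Vx)).
Qed.

End Support.

Section Coordinates.
Context (R : realType) (Y : completeNormedModType R) (Gamma : Type).
Variable Psi : {linear dual Y -> linfty_c R Gamma}.
Hypothesis Psi_wcont : continuous (Psi : weak_star Y -> linfty_c_ptws R Gamma).

Lemma coordinate_continuous g : continuous (fun f : weak_star Y => Psi f g : R).
Proof.
move=> f.
have c2 : continuous (fun u : linfty_c_ptws R Gamma => (u : linfty_c R Gamma) g : R).
  move=> u; apply: (@continuous_comp _ {ptws Gamma -> R} _
    (@linfty_c_fun R Gamma : linfty_c_ptws R Gamma -> {ptws Gamma -> R}) (proj g)).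
    exact: initial_continuous.
  exact: (@proj_continuous {classic Gamma} (fun=> R)).
apply: (@continuous_comp _ _ _ (Psi : weak_star Y -> linfty_c_ptws R Gamma)
  (fun u : linfty_c_ptws R Gamma => (u : linfty_c R Gamma) g : R)).
  exact: Psi_wcont.
exact: c2.
Qed.

Lemma coordinate_ball_continuous g :
  continuous (fun k : dual_ball Y => Psi (dual_of k) g : R).
Proof.
move=> k; apply: (@continuous_comp _ _ _ (@dual_of _ Y : _ -> weak_star Y)
  (fun f : weak_star Y => Psi f g : R)).
  exact: dual_of_continuous.
exact: coordinate_continuous.
Qed.

Lemma coordinate_countable f : countable [set g | Psi f g != 0].
Proof. by have := linfty_cP (Psi f); rewrite inE => -[]. Qed.

Lemma coordinateP a f f' g : Psi (a *: f + f') g = a * Psi f g + Psi f' g.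
Proof. by rewrite linearP. Qed.

Lemma coordinateZ a f g : Psi (a *: f) g = a * Psi f g.
Proof. by rewrite linearZ. Qed.

Lemma coordinateD f f' g : Psi (f + f') g = Psi f g + Psi f' g.
Proof. by rewrite linearD. Qed.

Lemma coordinate_sum n (f : 'I_n -> dual Y) g :
  Psi (\sum_(i < n) f i) g = \sum_(i < n) Psi (f i) g.
Proof.
rewrite linear_sum; elim/big_ind2 : _ => // u v u' v' <- <-; by [].
Qed.

Hypothesis Psi_cont : continuous Psi.

Lemma coordinate_bound : exists2 C : R, 0 < C & forall f g, `|Psi f g| <= C * `|f|.
Proof.
have /linear_boundedP := (linear_bounded_continuous Psi).2 Psi_cont.
move=> [r0 [_ rP]]; exists (`|r0| + 1); first by rewrite ltr_wpDl.
move=> f g; have r1 : r0 < `|r0| + 1 by rewrite (le_lt_trans (ler_norm _))// ltrDl.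
exact: le_trans (sup_norm_ubound _ _) (rP _ r1 f).
Qed.

Context d (T : measurableType d) (mu : {finite_measure set T -> \bar R}).
Local Notation X := (L1 mu Y).
Local Notation bm := (@bounded_measurable _ T R).

(** Brings a single coordinate of the pulls under the scalar theory, so that densities and the
    orthonormal system apply to it. *)
Lemma pull_coordinate_functional (phi : dual X) g :
  exists C, bounded_functional mu (fun h => Psi (pull phi h) g) C.
Proof.
have [C C0 CP] := coordinate_bound.
exists (C * `|phi|); split.
- by move=> h k bh bk; rewrite pullD// coordinateD.
- by move=> a h bh; rewrite pullZ// coordinateZ.
by move=> h bh; rewrite (le_trans (CP _ _))// -mulrA ler_pM2l// norm_pull_le.
Qed.

Lemma pull_continuous h : bm h ->
  continuous (fun phi : weak_star X => pull phi h : weak_star Y).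
Proof.
move=> bh phi.
apply: (@weak_star_cvg R Y _ (nbhs (phi : weak_star X))
  (fun phi : weak_star X => pull phi h)) => y.
rewrite pullE//.
rewrite (_ : (fun i => _) = fun f : weak_star X => (f : dual X) (tensor mu h y) : R).
  exact: weak_star_eval_continuous.
by apply/funext => f; rewrite pullE.
Qed.

End Coordinates.

(** * Property (M) implies (ii) *)

Lemma quarterD (R : realType) (a : R) : a / 4 + a / 4 = a / 2.
Proof. lra. Qed.

Lemma half_le_of_dist (R : realType) (a b : R) : `|a - b| < `|a| / 2 ->
  `|a| / 2 <= `|b|.
Proof. by move=> /(le_lt_trans (lerB_dist a b)); lra. Qed.

Section CountableSupport.
Context (R : realType) (Y : completeNormedModType R) (Gamma : Type).
Variable Psi : {linear dual Y -> linfty_c R Gamma}.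
Hypothesis Psi_cont : continuous Psi.
Hypothesis Psi_wcont : continuous (Psi : weak_star Y -> linfty_c_ptws R Gamma).
Hypothesis propM : property_M R (dual_ball Y).
Context d (T : measurableType d) (mu : {finite_measure set T -> \bar R}).
Local Notation X := (L1 mu Y).
Local Notation bm := (@bounded_measurable _ T R).
Local Notation K := (dual_ball Y).
Local Notation m := (fine (mu setT)).

(** The set where coordinate [g] is nonzero is open; having positive mass it meets the support,
    hence the countable dense subset [D]. Each point of [D] has only countably many nonzero
    coordinates. *)
Lemma ball_coordinate_countable (P : probability (borel K) R) :
  regular_measure P ->
  countable [set g | (0 < P [set k : K | (Psi (dual_of k) g : R) != 0%R])%E].
Proof.
move=> rP; have [D [cD DS SD]] := propM rP.
have : countable (\bigcup_(k in D) [set g | Psi (dual_of k) g != 0]).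
  by apply: bigcup_countable => // k _; exact: coordinate_countable.
apply: sub_countable; apply: subset_card_le => g /= Pg.
have oU : open [set k : K | (Psi (dual_of k) g : R) != 0].
  apply: (@open_comp _ _ (fun k : K => Psi (dual_of k) g : R) [set x | x != 0]).
    by move=> k _; exact: coordinate_ball_continuous.
  exact: open_neq.
have [k Sk fk] := measure_support_meets rP oU Pg.
have [l [Dl fl]] := SD _ Sk _ (open_nbhs_nbhs (conj oU fk)).
by exists l.
Qed.

Section Unit.
Variable phi : dual X.
Hypothesis phi1 : `|phi| <= 1.
Hypothesis m0 : 0 < m.

Lemma block_average_ball : exists L : (T -> nat) -> nat -> K,
  forall p k, simple_fun p -> dual_of (L p k) = block_average phi p k.
Proof.
suff H p : exists L : nat -> K, forall k, simple_fun p ->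
    dual_of (L k) = block_average phi p k.
  by have [L LP] := choice H; exists L => p k; exact: LP.
have [sp|nsp] := pselect (simple_fun p); last by exists (fun=> point).
have [L LP] := choice (fun k => dual_ballE (block_average_le1 phi1 k sp)).
by exists L => k _.
Qed.

(** [P] regularises a limit of the distributions of the averaged fields. A nonzero coordinate of a
    pull keeps that coordinate of the fields large on sets whose measure is bounded below along the
    limit. *)
Lemma pull_measure : exists P : probability (borel K) R, regular_measure P /\
  forall A g, measurable A -> Psi (pull phi \1_A) g != 0 ->
  (0 < P [set k : K | (Psi (dual_of k) g : R) != 0%R])%E.
Proof.
have [L LP] := block_average_ball.
(* Along an ultrafilter the distributions converge on all subsets of [K] at once, so the limit is
   finitely additive on every set. *)
have [U [UU FU]] := ultraFilterLemma (partition_filter_proper T).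
have Usimple : U [set p : T -> nat | simple_fun p].
  by apply: FU; exists (fun=> 0%N); [exact: simple_cst|move=> p []].
(* The distribution of the averaged field under the normalised [mu]; every preimage is measurable
   because the field is simple. The value 0 at other labellings is not seen by [U]. *)
pose nu p (A : set K) : R :=
  if `[< simple_fun p >] then fine (mu ((L p \o p) @^-1` A)) / m else 0.
have mL p A : simple_fun p -> measurable ((L p \o p) @^-1` A).
  by move=> sp; apply: simple_preimage; exact: simple_comp.
have nuE p A : simple_fun p -> nu p A = fine (mu ((L p \o p) @^-1` A)) / m.
  by move=> sp; rewrite /nu asboolT.
have nu_ge0 p A : 0 <= nu p A.
  by rewrite /nu; case: asboolP => // sp; rewrite divr_ge0 ?fine_ge0.
have nu_le1 p A : `|nu p A| <= 1.
  rewrite ger0_norm// /nu; case: asboolP => // sp.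
  have mpA := mL p A sp.
  by rewrite ler_pdivrMr// mul1r fine_le ?fin_num_measure// le_measure ?inE.
have [nul nulP] := choice (fun A => ultra_bounded_cvg UU (fun p => nu_le1 p A)).
have lim_eq (f : (T -> nat) -> R) (a b : R) : f @ U --> a -> f @ U --> b -> a = b.
  by move=> fa fb; apply: (@cvg_unique _ (@norm_hausdorff R R^o) _ _ _ _ fa fb).
have near_cst (f : (T -> nat) -> R) (a : R) : (forall p, simple_fun p -> f p = a) ->
    f @ U --> a.
  move=> fa; apply: (@cvg_trans _ (cst a @ U)); last exact: cvg_cst.
  apply: near_eq_cvg; apply: filterS Usimple => p sp /=; rewrite fa//.
have nul_ge0 A : 0 <= nul A.
  apply: (closed_cvg (fun x : R => 0 <= x) _ _ _ (nulP A)); first exact: closed_ge.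
  by apply: nearW => p; exact: nu_ge0.
have nulT : nul setT = 1.
  apply: lim_eq (nulP setT) _; apply: near_cst => p sp.
  by rewrite nuE// preimage_setT divff// gt_eqF.
have nulU A B : A `&` B = set0 -> nul (A `|` B) = nul A + nul B.
  move=> AB; apply: lim_eq (nulP _) _.
  apply: (@cvg_trans _ ((fun p => nu p A + nu p B) @ U)); last first.
    by apply: cvgD; exact: nulP.
  apply: near_eq_cvg; apply: filterS Usimple => p sp /=.
  have mpA := mL p A sp; have mpB := mL p B sp.
  rewrite !nuE// preimage_setU measureU//; last by rewrite -preimage_setI AB preimage_set0.
  by rewrite fineD ?fin_num_measure// mulrDl.
have [P [rP nuP]] := regular_extension (@dual_ball_hausdorff R Y)
  (@dual_ball_compact R Y) nul_ge0 nulT nulU.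
exists P; split=> // A g mA.
set c := Psi _ g => c0; have cp : 0 < `|c| by rewrite normr_gt0.
have [C C0 CP] := coordinate_bound Psi_cont.
pose f (k : K) : R := Psi (dual_of k) g.
have fC k : `|f k| <= C.
  by rewrite (le_trans (CP _ _))// ler_piMr ?dual_of_norm// ltW.
(* Where the coordinate is below [e], it contributes at most [e * m], a quarter of |c|, to an
   integral that is at least |c|/2 for late [p]. *)
pose e := `|c| / 4 / m.
have e0 : 0 < e by rewrite !divr_gt0.
pose G := [set k : K | e <= `|f k|].
have fcont : continuous f by exact: coordinate_ball_continuous.
have nfcont : continuous (fun k : K => `|f k|).
  move=> k; have fk := fcont k. exact: (@cvg_norm _ R^o _ (nbhs k) _ f (f k) fk).
have cG : closed G.
  apply: (@closed_comp _ _ (fun k : K => `|f k|) [set x | e <= x]).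
    by move=> k _; exact: nfcont.
  exact: closed_ge.
have bA := bm_indic R mA.
have [b bP] := partition_functional phi1.
have [bphi bphiE] := dual_ballE phi1.
have cvb : Psi (pull (dual_of (b p)) \1_A) g @[p --> @partition_filter _ T] --> c.
  have PF := partition_filter_proper T.
  have cv := partition_approximation phi1 bP bphiE.
  have ct : continuous (fun q : dual_ball X => Psi (pull (dual_of q) \1_A) g : R).
    move=> q; apply: (@continuous_comp _ _ _ (@dual_of _ X : _ -> weak_star X)
      (fun f : weak_star X => Psi (pull f \1_A) g : R)).
      exact: dual_of_continuous.
    apply: (@continuous_comp _ _ _ (fun f : weak_star X => pull f \1_A : weak_star Y)
      (fun f : weak_star Y => Psi f g : R)).
      exact: pull_continuous.
    exact: coordinate_continuous.
  rewrite /c -bphiE.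
  exact: (@cvg_comp _ _ _ b (fun q : dual_ball X => Psi (pull (dual_of q) \1_A) g : R)
    _ _ _ cv (ct bphi)).
have c2 : 0 < `|c| / 2 by rewrite divr_gt0.
have Unear : U [set p | `|c| / 4 / C / m <= nu p G].
  have cvU : U [set p | `|c - Psi (pull (dual_of (b p)) \1_A) g| < `|c| / 2].
    have PF := partition_filter_proper T.
    have /cvgrPdist_lt cvb' := cvb; have H := cvb' _ c2.
    exact: FU _ H.
  apply: filterS2 Usimple cvU => p sp /= pc.
  set q := Psi _ g in pc.
  have q2 : `|c| / 2 <= `|q| by exact: half_le_of_dist.
  have [n pn] := simple_bounded sp.
  pose W := (L p \o p) @^-1` G.
  have mW : measurable W := mL p G sp.
  have bp (k : nat) : bm \1_(p @^-1` [set k]) by apply: bm_indic; exact: sp.2.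
  have qE : q = \int[mu]_t (\sum_(k < n)
      f (L p k) * (\1_A t * \1_(p @^-1` [set nat_of_ord k]) t)).
    rewrite /q (partition_functional_pull bP sp bA pn) coordinate_sum.
    rewrite (bm_integral_sum mu n (fun k => bmZ (f (L p k)) (bmM bA (bp k)))).
    apply: eq_bigr => k _; rewrite coordinateZ bm_integralZ; last exact: bmM.
    by rewrite mulrC /f LP.
  have qE' : q = \int[mu]_t (\1_A t * f (L p (p t))).
    rewrite qE; apply: eq_Rintegral => t _.
    rewrite (bigD1 (Ordinal (pn t)))//= big1 ?addr0.
      by rewrite [X in _ * (_ * X)]indicE mem_set// mulr1 mulrC.
    move=> k kt; rewrite [X in _ * (_ * X)]indicE memNset ?mulr0//= => ptk.
    by move: kt; rewrite -val_eqE/= ptk eqxx.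
  have bf : bm (fun t => f (L p (p t))).
    by apply: bm_simple; exact: (simple_comp (fun k => f (L p k)) sp).
  have bW := bm_indic R mW.
  have bCW := bmZ C bW; have be := bm_cst T e.
  (* The coordinate is bounded by [C] on [W] and by [e] off it, which leaves at least |c|/4 for [C]
     times the measure of [W]. *)
  have : `|q| <= \int[mu]_t (C * \1_W t + e).
    rewrite qE' (le_trans (le_normr_Rintegral _ _))//.
      by apply: bm_integrable; exact: bmM bA bf.
    apply: le_Rintegral => //.
    - by apply: bm_integrable; apply: bm_norm; exact: bmM bA bf.
    - by apply: bm_integrable; exact: bmD bCW be.
    move=> t _; rewrite normrM (@le_trans _ _ `|f (L p (p t))|)//.
      by rewrite ler_piMl// indicE; case: (_ \in _); rewrite ?normr1 ?normr0.
    rewrite indicE; have [tW|tW] := pselect (W t).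
      by rewrite mem_set// mulr1 (le_trans (fC _))// lerDl ltW.
    rewrite memNset// mulr0 add0r; move/negP: tW; rewrite -ltNge; exact: ltW.
  rewrite (bm_integralD mu bCW be) bm_integralZ// bm_integral_indic//.
  rewrite Rintegral_cst// => qW.
  have em : e * m = `|c| / 4 by rewrite /e divfK// gt_eqF.
  rewrite nuE// ler_pM2r ?invr_gt0// ler_pdivrMr// [leRHS]mulrC -/W.
  rewrite -(lerD2r (`|c| / 4)) -[X in _ <= _ + X]em (le_trans _ qW)//.
  by rewrite quarterD.
have nulG : `|c| / 4 / C / m <= nul G.
  apply: (closed_cvg (fun x : R => `|c| / 4 / C / m <= x) _ _ _ (nulP G)).
    exact: closed_ge.
  exact: Unear.
(* [nul] bounds [P] from below on closed sets only, hence the threshold set [G] in place of the open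
   set where [f] is nonzero. *)
have : (0 < P G)%E.
  apply: lt_le_trans (nuP G cG); rewrite lte_fin (lt_le_trans _ nulG)//.
  by rewrite !divr_gt0.
move=> /lt_le_trans; apply; apply: le_measure; rewrite ?inE.
- rewrite -[G]setCK; apply: measurableC; apply: sub_sigma_algebra.
  exact: closed_openC.
- apply: sub_sigma_algebra.
  apply: (@open_comp _ _ f [set x | x != 0]); first by move=> k _; exact: fcont.
  exact: open_neq.
by move=> k /= Gk; rewrite -normr_gt0 (lt_le_trans e0).
Qed.

End Unit.

Lemma countable_pull_support (phi : dual X) :
  countable [set g | exists2 A, measurable A & Psi (pull phi \1_A) g != 0].
Proof.
have [m0|m0] := leP m 0.
  apply: (@sub_countable _ _ _ set0) => //; apply: subset_card_le => g [A mA].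
  have [C C0 CP] := coordinate_bound Psi_cont.
  apply/negP; rewrite negbK -normr_le0 (le_trans (CP _ _))//.
  rewrite pmulr_rle0//; apply: le_trans (norm_pull_le _ (bm_indic R mA)) _.
  rewrite mulr_ge0_le0//; apply: le_trans m0.
  rewrite (@eq_Rintegral _ _ _ mu setT \1_A); last first.
    by move=> t _; rewrite ger0_norm// indicE.
  rewrite bm_integral_indic// fine_le ?fin_num_measure//.
  by rewrite le_measure ?inE.
have s0 : 0 < (`|phi| + 1)^-1 by rewrite invr_gt0 ltr_wpDl.
(* Rescaling into the unit ball leaves the nonzero coordinates unchanged; the 1 covers [phi = 0]. *)
pose phi' := (`|phi| + 1)^-1 *: phi.
have phi1 : `|phi'| <= 1.
  by rewrite normrZ gtr0_norm// mulrC ler_pdivrMr ?ltr_wpDl// mul1r lerDl.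
have [P [rP PP]] := pull_measure phi1 m0.
apply: sub_countable (ball_coordinate_countable rP).
apply: subset_card_le => g [A mA gA]; apply: (PP A g mA).
have bA := bm_indic R mA.
rewrite -[phi']addr0 pull_linear//.
have -> : pull (0 : dual X) \1_A = 0 by apply: dual_ext => y; rewrite pullE.
by rewrite addr0 coordinateZ mulf_neq0// gt_eqF.
Qed.

End CountableSupport.

Lemma linfty_c_ptws_cvg (R : realType) (Gamma : Type) (I : Type)
    (F : set_system I) (u : I -> linfty_c_ptws R Gamma)
    (f : linfty_c_ptws R Gamma) : Filter F ->
  (forall g, (u i : linfty_c R Gamma) g @[i --> F] --> (f : linfty_c R Gamma) g) ->
  u @ F --> f.
Proof.
move=> FF cv; apply: (@initial_cvg _ _ _ _ F u f FF).
have FF' : Filter ((linfty_c_fun (Gamma := Gamma) \o u) @ F) by exact: fmap_filter.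
apply/cvg_sup => g.
exact: (@initial_cvg _ R (proj g) _ _ id _ FF' (cv g)).
Qed.

(** * The witness that L1(mu, Y) is WLD *)

Section WLDBochner.
Context (R : realType) (Y : completeNormedModType R) (Gamma : Type).
Variable Psi : {linear dual Y -> linfty_c R Gamma}.
Hypothesis Psi_cont : continuous Psi.
Hypothesis Psi_inj : injective Psi.
Hypothesis Psi_wcont : continuous (Psi : weak_star Y -> linfty_c_ptws R Gamma).
Hypothesis propM : property_M R (dual_ball Y).
Context d (T : measurableType d) (mu : {finite_measure set T -> \bar R}).
Local Notation X := (L1 mu Y).
Local Notation bm := (@bounded_measurable _ T R).

Lemma coordinate_inj f : (forall g, Psi f g = 0) -> f = 0.
Proof.
move=> f0; apply: Psi_inj; rewrite linear0; apply/val_inj/funext => g.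
exact: f0.
Qed.

Lemma zero_functional : bounded_functional mu (fun=> 0) 0.
Proof.
split=> [h k _ _|a h _|h _]; rewrite ?addr0 ?mulr0 ?mul0r//.
by rewrite normr0.
Qed.

(** Otherwise the scalar functional of this coordinate vanishes on all indicators, hence on all
    bounded measurable functions. *)
Lemma pull_coordinate_indic (phi : dual X) g h : bm h -> Psi (pull phi h) g != 0 ->
  exists2 A, measurable A & Psi (pull phi \1_A) g != 0.
Proof.
move=> bh hg; apply: contrapT => nA; move/eqP: hg; apply.
have [C bf] := pull_coordinate_functional Psi_cont phi g.
apply: (bf_ext bf zero_functional) => // A mA.
by apply: contrapT => /eqP Ag; apply: nA; exists A.
Qed.

(** The witness sends [phi] to the family [Psi (pull phi e) g] indexed by [e] in the total system
    and [g] in [Gamma]. Only countably many [g] matter, and for each of them countably many [e];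
    totality gives injectivity. *)
Lemma WLD_L1 : inhabited Gamma -> WLD X.
Proof.
move=> [g0]; have [E [C0 [EP Ecount Etot]]] := total_system mu.
have [C Cp CP] := coordinate_bound Psi_cont.
(* Extension by 0 outside [E] replaces indexing by a subtype. *)
pose F (phi : dual X) (i : (T -> R) * Gamma) : R^o :=
  if `[< E i.1 >] then Psi (pull phi i.1) i.2 else 0.
have FE (phi : dual X) e g : E e -> F phi (e, g) = Psi (pull phi e) g.
  by move=> Ee; rewrite /F asboolT.
have FN (phi : dual X) e g : ~ E e -> F phi (e, g) = 0.
  by move=> Ee; rewrite /F asboolF.
have F_le phi i : `|F phi i| <= C * `|C0| * `|phi|.
  case: i => e g; have [Ee|nEe] := pselect (E e); last first.
    by rewrite FN// normr0 !mulr_ge0// ltW.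
  have [be e1] := EP e Ee.
  rewrite FE// (le_trans (CP _ _))// -mulrA ler_pM2l//.
  rewrite (le_trans (norm_pull_le _ be))// mulrC ler_wpM2r//.
  by rewrite (le_trans e1)// ler_norm.
have FP phi : F phi \in @linfty_c_pred R ((T -> R) * Gamma).
  rewrite inE; split; first by exists (C * `|C0| * `|phi|).
  have cG := countable_pull_support Psi_cont Psi_wcont propM phi.
  set G := [set g | _] in cG.
  have : countable (\bigcup_(g in G)
      ((fun e => (e, g)) @` [set e | E e /\ Psi (pull phi e) g != 0])).
    apply: bigcup_countable => // g _.
    have [C' bf] := pull_coordinate_functional Psi_cont phi g.
    exact: (sub_countable (card_image_le _ _) (Ecount _ _ bf)).
  apply: sub_countable; apply: subset_card_le => -[e g] /= Feg.
  have [Ee|nEe] := pselect (E e); last by rewrite FN// eqxx in Feg.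
  rewrite FE// in Feg; have [be _] := EP e Ee.
  exists g; first exact: pull_coordinate_indic be Feg.
  by exists e.
pose Phi (phi : dual X) : linfty_c R ((T -> R) * Gamma) := LinftyC (FP phi).
have PhiE phi i : Phi phi i = F phi i by [].
have lPhi : linear Phi.
  move=> a phi psi; apply/val_inj/funext => -[e g].
  rewrite -[LHS]/(F (a *: phi + psi) (e, g)).
  rewrite -[RHS]/(a * F phi (e, g) + F psi (e, g)).
  have [Ee|nEe] := pselect (E e); last by rewrite !FN// mulr0 addr0.
  by rewrite !FE// pull_linear ?coordinateP//; have [] := EP e Ee.
pose PhiL := HB.pack Phi (GRing.isLinear.Build R (dual X)
  (linfty_c R ((T -> R) * Gamma)) _ Phi lPhi) :
  {linear dual X -> linfty_c R ((T -> R) * Gamma)}.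
exists ((T -> R) * Gamma)%type, (inhabits (cst 0, g0)), PhiL; split.
- apply: bounded_linear_continuous; apply/bounded_funP => r.
  exists (C * `|C0| * `|r|) => phi phir.
  apply: sup_norm_le; first by rewrite !mulr_ge0// ltW.
  move=> i; rewrite (le_trans (F_le phi i))// ler_wpM2l ?mulr_ge0 ?(ltW Cp)//.
  by rewrite (le_trans phir)// ler_norm.
- move=> phi psi pp; apply: pull_inj => A mA.
  have bA := bm_indic R mA.
  apply/eqP; rewrite -subr_eq0; apply/eqP; apply: coordinate_inj => g.
  pose dl := (-1) *: psi + phi.
  have [C' bf] := pull_coordinate_functional Psi_cont dl g.
  have -> : pull phi \1_A - pull psi \1_A = pull dl \1_A.
    by rewrite pull_linear// scaleN1r addrC.
  apply: (Etot _ _ bf) => // e Ee; rewrite -FE// -PhiE.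
  have pp' : Phi phi = Phi psi := pp.
  have -> : Phi dl = 0 by rewrite /dl lPhi pp' scaleN1r addNr.
  by [].
- move=> phi.
  apply: (@linfty_c_ptws_cvg R _ _ (nbhs (phi : weak_star X)) PhiL) => -[e g].
  have [Ee|nEe] := pselect (E e); last first.
    rewrite (_ : (fun _ => _) = cst 0); first by rewrite [PhiL phi _]FN//; exact: cvg_cst.
    by apply/funext => psi; exact: FN.
  rewrite (_ : (fun _ => _) = fun psi : weak_star X => Psi (pull psi e) g : R).
    rewrite [PhiL phi _]FE//.
    apply: (@continuous_comp _ _ _ (fun f : weak_star X => pull f e : weak_star Y)
      (fun f : weak_star Y => Psi f g : R)).
      by apply: pull_continuous; have [] := EP e Ee.
    exact: coordinate_continuous.
  by apply/funext => psi; exact: FE.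
Qed.

End WLDBochner.

(** * Quotients and weak* continuous functionals *)

Section WeakStarEvaluation.
Context (R : realType) (Y : normedModType R).

(** Induction on the list: subtracting a multiple of the evaluation at [y0] leaves a functional
    vanishing on the common kernel of the remaining points. *)
Lemma kernel_evaluation (ys : seq Y) (F : dual Y -> R) :
  (forall a f g, F (a *: f + g) = a * F f + F g) ->
  (forall f : dual Y, (forall y, y \in ys -> f y = 0) -> F f = 0) ->
  exists y, forall f : dual Y, F f = f y.
Proof.
elim: ys F => [|y0 ys IHys] F lF F0.
  by exists 0 => f; rewrite linear0 F0.
have FZ a f : F (a *: f) = a * F f.
  by have := lF a f 0; rewrite addr0 => ->; rewrite [F 0]F0 ?addr0.
have [[f0 [f00 f0y]]|nf] := pselect (exists f0 : dual Y,
    (forall y, y \in ys -> f0 y = 0) /\ f0 y0 != 0); last first.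
  apply: IHys => // f fys; apply: F0 => y; rewrite inE => /predU1P[->|]; last exact: fys.
  by apply: contrapT => /eqP fy; apply: nf; exists f.
(* The multiple for which the difference vanishes at [f0], a functional killing [ys] but not
   [y0]. *)
pose c := F f0 / f0 y0.
have [|f fys|y yE] := IHys (fun f => F f - c * f y0).
- by move=> a f g; rewrite lF dual_linear_apply; ring.
- have : F (- (f y0 / f0 y0) *: f0 + f) = 0.
    apply: F0 => y; rewrite inE dual_linear_apply => /predU1P[->|yys].
      by rewrite mulNr divfK// addNr.
    by rewrite (f00 y yys) (fys y yys) mulr0 addr0.
  rewrite lF => H; rewrite -[RHS]H /c; ring.
exists (c *: y0 + y) => f.
have -> : f (c *: y0 + y) = c * f y0 + f y := linearP f c y0 y.
by rewrite -yE; ring.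
Qed.

(** Continuity gives |F| < 1 on a basic neighbourhood of 0 determined by finitely many points. Their
    common kernel is a subspace contained in it, so [F] vanishes on that kernel. *)
Lemma weak_star_evaluation (F : dual Y -> R) :
  (forall a f g, F (a *: f + g) = a * F f + F g) ->
  continuous (F : weak_star Y -> R) ->
  exists y, forall f : dual Y, F f = f y.
Proof.
move=> lF cF.
pose B (i : seq Y * R) := [set f : weak_star Y | forall y, y \in i.1 ->
  `|(f : dual Y) y| < i.2].
pose FF := filter_from [set i : seq Y * R | 0 < i.2] B.
have FFF : Filter FF.
  apply: filter_from_filter; first by exists ([::], 1) => /=.
  move=> [ys e] [zs u] /= e0 u0; exists (ys ++ zs, Num.min e u) => /=.
    by rewrite lt_min e0.
  move=> f fB; split=> y yin; have := fB y; rewrite mem_cat yin ?orbT => /(_ isT);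
    by rewrite /= lt_min => /andP[].
have F0 : F 0 = 0 by have := lF (-1) 0 0; rewrite scaler0 addr0 mulN1r addNr.
have cv : id @ FF --> (0 : weak_star Y).
  apply: weak_star_cvg => y; apply/cvgrPdist_lt => e e0.
  exists ([:: y], e) => // f /(_ y); rewrite inE eqxx => /(_ isT).
  by rewrite sub0r normrN.
have : nbhs (0 : weak_star Y) [set f | `|F f| < 1].
  have /cvgrPdist_lt/(_ _ ltr01) := cF (0 : weak_star Y).
  by apply: filterS => f; rewrite F0 sub0r normrN.
move=> /cv [[ys e] /= e0 BF].
apply: (@kernel_evaluation ys) => // f fys; apply/eqP; apply: contrapT => /negP Ff.
have FZ a : F (a *: f) = a * F f by have := lF a f 0; rewrite !addr0 F0 addr0.
have : `|F ((F f)^-1 *: f)| < 1.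
  by apply: BF => y yys; rewrite dual_scale_apply (fys y yys) mulr0 normr0.
by rewrite FZ mulVf// normr1 ltxx.
Qed.

End WeakStarEvaluation.

(** * Passage of WLD to quotients *)

Section WLDQuotient.
Context (R : realType) (X Y : completeNormedModType R).
Variable e : {linear X -> Y}.
Hypothesis (e_le : forall x, `|e x| <= `|x|) (e_surj : forall y, exists x, e x = y).

(** The adjoint [J] of [e] is bounded, weak* continuous, and injective because [e] is onto, so
    composing a witness for [X] with [J] gives one for [Y]. *)
Lemma WLD_quotient : WLD X -> WLD Y.
Proof.
move=> [Gamma [G0 [Phi [Phi_cont Phi_inj Phi_wcont]]]].
have lP (f : dual Y) : linear (fun x => f (e x) : R^o).
  by move=> a x y; rewrite !linearP.
have fP (f : dual Y) : (fun x => f (e x) : R^o) \in @dual_pred R X.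
  rewrite inE; split; first exact: lP.
  apply: (linear_le_continuous (M := `|f|) (lP f)) => x.
  by rewrite (le_trans (dual_apply_le _ _))// ler_wpM2l.
pose J (f : dual Y) : dual X := Dual (fP f).
have JE f x : J f x = f (e x) by [].
have lJ a f g : J (a *: f + g) = a *: J f + J g by apply: dual_ext.
have J_le f : `|J f| <= `|f|.
  apply: dual_norm_le => x x1; rewrite (le_trans (dual_apply_le f _))//.
  by rewrite ler_piMr// (le_trans (e_le x)).
have lPJ : linear (Phi \o J) by move=> a f g; rewrite /= lJ linearP.
pose PJ := HB.pack (Phi \o J) (GRing.isLinear.Build R (dual Y)
  (linfty_c R Gamma) _ (Phi \o J) lPJ) : {linear dual Y -> linfty_c R Gamma}.
have [C C0 CP] := coordinate_bound Phi_cont.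
exists Gamma, G0, PJ; split.
- apply: bounded_linear_continuous; apply/bounded_funP => r.
  exists (C * `|r|) => f fr; apply: sup_norm_le; first by rewrite mulr_ge0// ltW.
  move=> g; rewrite (le_trans (CP _ _))// ler_pM2l// (le_trans (J_le f))//.
  by rewrite (le_trans fr)// ler_norm.
- move=> f g /Phi_inj fg; apply: dual_ext => y; have [x <-] := e_surj y.
  by rewrite -!JE fg.
- move=> f; apply: (@continuous_comp _ _ _ (J : weak_star Y -> weak_star X)
    (Phi : weak_star X -> linfty_c_ptws R Gamma)); last exact: Phi_wcont.
  apply: (@weak_star_cvg R X _ (nbhs (f : weak_star Y)) (J : _ -> weak_star X)) => x.
  exact: (@weak_star_eval_continuous R Y (e x) f).
Qed.

End WLDQuotient.

(** * Property (M) from (ii) *)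

Section DiracSpace.
Context (R : realType) (Y : completeNormedModType R).
Local Open Scope quotient_scope.

(** For the Dirac mass on a one-point space null sets are empty, so evaluation at the point is a
    linear contraction of the space of classes onto [Y]. *)
Lemma WLD_dirac : (forall (d : measure_display) (T : measurableType d)
    (mu : {finite_measure set T -> \bar R}), WLD (L1 mu Y)) -> WLD Y.
Proof.
pose mu : {finite_measure set unit -> \bar R} := @dirac _ unit tt R.
move=> /(_ _ _ mu); set X := L1 mu Y => WX.
have aeP (P : unit -> Prop) : {ae mu, forall t, P t} -> P tt.
  move=> [N [mN N0 sN]]; apply: contrapT => nP; have Nt : N tt by exact: sN.
  move: N0; rewrite [mu N]diracE mem_set//= => /eqP.
  by rewrite eqe oner_eq0.
pose e0 (q : X) : Y := (repr q : bochner mu Y) tt.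
have le0 : linear e0.
  move=> a p q.
  have E : a *: p + q = \pi_X (a *: repr p + repr q).
    by rewrite L1_piD [_ *: p]/(L1_scale a p) reprK.
  have := L1_reprP (a *: repr p + repr q); rewrite -E => /aeP H.
  by rewrite /e0 H.
pose e := HB.pack e0 (GRing.isLinear.Build R X Y _ e0 le0) : {linear X -> Y}.
apply: (@WLD_quotient R X Y e) => // [q|y].
  rewrite -[leRHS]/(L1_norm q) /L1_norm /int_norm integral_dirac//.
  by rewrite diracT mul1e.
have b1 : bounded_measurable (cst 1 : unit -> R) by exact: bm_cst.
have [F FE FE'] := classE (tensor_bochner mu y b1).
exists (tensor mu (cst 1) y).
have H := aeP _ (L1_reprP F).
have -> : e (tensor mu (cst 1) y) = F tt by rewrite -[LHS]/(e0 _) /e0 [tensor _ _ _]FE' H.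
by rewrite -FE scale1r.
Qed.

End DiracSpace.

Lemma borel_measurable_continuous (R : realType) (K : ptopologicalType)
    (f : K -> R) : continuous f -> measurable_fun setT (f : borel K -> R).
Proof.
move=> cf; apply: (measurability _ (RGenOInfty.measurableE R)) => //.
move=> _ [_ [a ->] <-]; rewrite setTI; apply: sub_sigma_algebra.
apply: (@open_comp _ _ f) => [k _|]; first exact: cf.
exact: interval_open.
Qed.

(** * Functionals on a WLD space L1(mu, Y) involve countably many coordinates *)

Section CountableBarycenter.
Context (R : realType) (Y : completeNormedModType R) (Gamma : Type).
Variable Psi : {linear dual Y -> linfty_c R Gamma}.
Hypothesis Psi_wcont : continuous (Psi : weak_star Y -> linfty_c_ptws R Gamma).
Context d (T : measurableType d) (mu : {finite_measure set T -> \bar R}).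
Local Notation X := (L1 mu Y).
Hypothesis WX : WLD X.

(** Countable tightness makes [phi] a weak* cluster point of a sequence of partition functionals. A
    coordinate vanishing on all their block averages vanishes on their pulls, and this is a weak*
    closed condition. *)
Lemma coordinate_barycenter_countable (phi : dual X) : `|phi| <= 1 ->
  exists G : set Gamma, countable G /\
  forall g, ~ G g -> forall A : set T, measurable A ->
    Psi (pull phi \1_A) g = 0.
Proof.
move=> phi1.
have [Delta [D0 [Phi [Phi_cont Phi_inj Phi_wcont]]]] := WX.
have [b bP] := partition_functional phi1.
have [bphi bphiE] := dual_ballE phi1.
have PF := partition_filter_proper T.
have cv := partition_approximation phi1 bP bphiE.
have clA : closure [set b p | p in [set p : T -> nat | simple_fun p]] bphi.
  move=> U /cv FU; have Fs : partition_filter [set p : T -> nat | simple_fun p].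
    by exists (fun=> 0%N); [exact: simple_cst|move=> p []].
  have FbU : @partition_filter _ T (b @^-1` U) := FU.
  have [p [Up sp]] := filter_ex (filterI FbU Fs).
  by exists (b p); split=> //; exists p.
have [a [aA acl]] : exists a : nat -> dual_ball X,
    (forall n, [set b p | p in [set p : T -> nat | simple_fun p]] (a n)) /\
    cluster (a @ \oo) bphi.
  apply: (@countable_tightness R (dual_ball X) Delta (fun q i => Phi (dual_of q) i)) => //.
  - by move=> i; exact: coordinate_ball_continuous.
  - exact: dual_ball_compact.
  - move=> q q' qq; apply: dual_of_inj; apply: Phi_inj; apply/val_inj/funext => i.
    exact: (congr1 (@^~ i) qq).
  - by move=> q; exact: coordinate_countable.
have aE n : exists p : T -> nat, simple_fun p /\ b p = a n.
  by have [p sp pE] := aA n; exists p.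
have [p pP] := choice aE.
exists (\bigcup_(n in [set: nat]) \bigcup_(k in [set: nat])
  [set g | Psi (block_average phi (p n) k) g != 0]); split.
  apply: bigcup_countable => // n _; apply: bigcup_countable => // k _.
  exact: coordinate_countable.
move=> g ng A mA; have bA := bm_indic R mA.
have an0 n : Psi (pull (dual_of (a n)) \1_A) g = 0.
  have [sp <-] := pP n; have [m pm] := simple_bounded sp.
  rewrite (partition_functional_pull bP sp bA pm) coordinate_sum big1// => k _.
  rewrite coordinateZ; have [->|nz] := eqVneq (Psi (block_average phi (p n) k) g) 0.
    by rewrite mulr0.
  by exfalso; apply: ng; exists n => //; exists (nat_of_ord k).
have ct : continuous (fun q : dual_ball X => Psi (pull (dual_of q) \1_A) g : R).
  move=> q; apply: (@continuous_comp _ _ _ (@dual_of _ X : _ -> weak_star X)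
    (fun f : weak_star X => Psi (pull f \1_A) g : R)).
    exact: dual_of_continuous.
  apply: (@continuous_comp _ _ _ (fun f : weak_star X => pull f \1_A : weak_star Y)
    (fun f : weak_star Y => Psi f g : R)).
    exact: pull_continuous.
  exact: coordinate_continuous.
have cl0 : closed [set q : dual_ball X | (Psi (pull (dual_of q) \1_A) g : R) = 0].
  apply: (@closed_comp _ _ (fun q : dual_ball X => Psi (pull (dual_of q) \1_A) g : R)
    [set x | x = 0]); first by move=> q _; exact: ct.
  exact: closed_eq.
have := cl0 bphi; rewrite /= bphiE; apply=> U nU.
have aF : (a @ \oo) [set q | (Psi (pull (dual_of q) \1_A) g : R) = 0].
  by exists 0%N => // n _; exact: an0.
by have [q [q0 Uq]] := acl _ U aF nU; exists q.
Qed.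

End CountableBarycenter.

(** * Separability of the support of a regular probability *)

Section PropertyM.
Context (R : realType) (Y : completeNormedModType R) (Gamma : Type).
Variable Psi : {linear dual Y -> linfty_c R Gamma}.
Hypothesis Psi_inj : injective Psi.
Hypothesis Psi_wcont : continuous (Psi : weak_star Y -> linfty_c_ptws R Gamma).
Local Notation K := (dual_ball Y).
Variable P : probability (borel K) R.
Variable mu : {finite_measure set (borel K) -> \bar R}.
Hypothesis muP : forall A, mu A = P A.
Local Notation X := (L1 mu Y).
Hypothesis WX : WLD X.

Lemma support_closed : closed (measure_support P).
Proof.
rewrite -[measure_support P]setCK; apply: open_closedC.
rewrite openE => k /= kS.
have [U [oU Uk PU]] : exists U, [/\ open U, U k & ~ (0 < P U)%E].
  apply: contrapT => nU; apply: kS => U oU Uk; apply: contrapT => PU.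
  by apply: nU; exists U.
apply: (filterS _ (open_nbhs_nbhs (conj oU Uk))) => l Ul lS.
exact: PU (lS U oU Ul).
Qed.

(** Otherwise [v] exceeds half of [v k] on an open neighbourhood of [k], which has positive measure
    because [k] is in the support; the integral of [v] over it would be positive. *)
Lemma support_le0 (v : K -> R) : continuous v ->
  bounded_measurable (v : borel K -> R) ->
  (forall A : set (borel K), measurable A -> \int[mu]_k (\1_A k * v k) = 0) ->
  forall k, measure_support P k -> v k <= 0.
Proof.
move=> cv bv v0 k Sk; rewrite leNgt; apply/negP => vk.
pose e := v k / 2; have e0 : 0 < e by rewrite divr_gt0.
pose A : set (borel K) := [set l : K | e < v l].
have oA : open (A : set K).
  by apply: (@open_comp _ _ v [set x | e < x]); [move=> l _; exact: cv|exact: open_gt].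
have mA : measurable A by exact: sub_sigma_algebra.
have PA : (0 < P A)%E.
  by apply: Sk => //; rewrite /A /= /e ltr_pdivrMr// ltr_pMr// ltr1n.
have bA := bm_indic R mA.
have : e * fine (mu A) <= 0.
  rewrite -(v0 A mA) -bm_integral_indic// -bm_integralZ//.
  apply: le_Rintegral => //.
  - by apply: bm_integrable; exact: bmZ.
  - by apply: bm_integrable; exact: bmM.
  move=> l _; rewrite indicE; have [lA|lA] := pselect (A l).
    by rewrite mem_set// mulr1 mul1r ltW.
  by rewrite memNset// mulr0 mul0r.
apply/negP; rewrite -ltNge mulr_gt0// fine_gt0// muP PA/=.
exact: le_lt_trans (probability_le1 P mA) (ltry _).
Qed.

(** The field used is the inclusion of the ball into the dual, over the ball itself. *)
Lemma ball_barycenter : exists phi : dual X, `|phi| <= 1 /\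
  forall (h : borel K -> R) y, bounded_measurable h ->
    phi (tensor mu h y) = \int[mu]_k (h k * dual_of (k : K) y).
Proof.
pose s (k : borel K) : dual Y := dual_of (k : K).
have ms y : measurable_fun setT (fun k => s k y : R).
  by apply: borel_measurable_continuous; exact: dual_of_eval_continuous.
have s1 k : `|s k| <= 1 by exact: dual_of_norm.
have [phi [phi1 phiE]] := field_functional mu ms s1.
by exists phi; split=> // h y bh; rewrite phiE.
Qed.

(** All coordinates outside a countable set [G] vanish on the support, so those in [G] separate its
    points and compactness yields separability. *)
Lemma support_separable : separable_set (measure_support P).
Proof.
have [phi [phi1 phiE]] := ball_barycenter.
have [G [cG GP]] := coordinate_barycenter_countable Psi_wcont WX phi1.
have S0 g k : ~ G g -> measure_support P k -> Psi (dual_of k) g = 0.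
  move=> Gg Sk.
  (* As an evaluation at [y], coordinate [g] has an integral over [A] equal to coordinate [g] of a
     pull of [phi], which is 0; both signs are then tested on the support. *)
  have [y yE] := @weak_star_evaluation R Y (fun f => Psi f g)
    (fun a f f' => coordinateP Psi a f f' g) (@coordinate_continuous _ _ _ _ Psi_wcont g).
  have c1 : continuous (fun l : K => dual_of l y : R) by exact: dual_of_eval_continuous.
  have c2 : continuous (fun l : K => - dual_of l y : R).
    move=> l; have cl := c1 l.
    exact: (@cvgN _ R^o _ (nbhs l) _ (fun l : K => dual_of l y : R^o) _ cl).
  have b1 : bounded_measurable (fun l : borel K => dual_of (l : K) y : R).
    split; first exact: borel_measurable_continuous.
    by exists `|y| => l; exact: dual_of_le.
  have b2 := bmN b1.
  have I0 (A : set (borel K)) : measurable A ->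
      \int[mu]_l (\1_A l * dual_of (l : K) y) = 0.
    by move=> mA; rewrite -phiE -?pullE -?yE ?GP//; exact: bm_indic.
  rewrite yE; apply/eqP; rewrite eq_le (support_le0 c1 b1)//=.
  rewrite -oppr_le0 (support_le0 c2 b2)// => A mA.
  have bA := bm_indic R mA.
  rewrite (@eq_Rintegral _ _ _ mu setT (fun l => -1 * (\1_A l * dual_of (l : K) y))).
    by rewrite bm_integralZ ?I0 ?mulr0//; exact: bmM.
  by move=> l _; rewrite mulrN mulN1r.
(* With no coordinates at all, injectivity of [Psi] reduces the ball to a single point. *)
have [iG|nG] := pselect (inhabited Gamma); last first.
  exists (measure_support P); split=> //; last exact: subset_closure.
  have all_eq (k l : K) : k = l.
    apply: dual_of_inj; apply: Psi_inj; apply/val_inj/funext => g.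
    by exfalso; apply: nG; exists.
  apply: (@sub_countable _ _ _ [set point : K]); last exact: countable1.
  by apply: subset_card_le => k _ /=; exact: all_eq.
have [e eP] := countable_enum iG cG.
apply: (@compact_separable R K (fun k i => Psi (dual_of k) (e i))).
- by move=> i; exact: coordinate_ball_continuous.
- exact: (subclosed_compact support_closed (@dual_ball_compact R Y)).
move=> k l Sk Sl kl; apply: dual_of_inj; apply: Psi_inj; apply/val_inj/funext => g.
have [Gg|Gg] := pselect (G g); last by rewrite /= !S0.
by have [i <-] := eP g Gg; exact: (congr1 (@^~ i) kl).
Qed.

End PropertyM.

Theorem corollary4p6 (R : realType) (Y : completeNormedModType R) :
  (WLD Y /\ property_M R (dual_ball Y)) <->
  (forall (d : measure_display) (T : measurableType d)
    (mu : {finite_measure set T -> \bar R}), WLD (L1 mu Y)).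
Proof.
split=> [[[Gamma [G0 [Psi [Psi_cont Psi_inj Psi_wcont]]]] pM] d T mu|H].
  exact: (WLD_L1 Psi_cont Psi_inj Psi_wcont pM mu G0).
have WY := WLD_dirac H; split=> // P rP.
have [Gamma [G0 [Psi [Psi_cont Psi_inj Psi_wcont]]]] := WY.
(* Statement (ii) is applied to [P] itself, as a finite measure on the Borel sets of the ball. *)
exact: (support_separable Psi_inj Psi_wcont (fun=> erefl) (H _ _ P)).
Qed.
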